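(* Let $0<\lambda<1/e$, $E(z)=\lambda e^z$, and let $s>1$. Let $h(t)=t/L^s(1/t)$ (defined for small $t>0$). Then $\mathcal H^h(\mathcal J(E)\setminus\mathcal C)=\infty$.
   Context: For $0<\lambda<1/e$ the function $E(z)=\lambda e^z$ has two real fixed points $\alpha<1<\beta$, $\alpha$ attracting, $\beta$ repelling, with $E'(\beta)=\beta$. $\mathcal J(E)$ is the Julia set (complement of the set where the iterates form a normal family). By Devaney–Krych, $\mathcal J(E)$ is a union of pairwise disjoint curves (''hairs'') each connecting a finite point (its endpoint) with $\infty$; each hair is the set of points of $\mathcal J(E)$ sharing a given itinerary (the sequence $(s_j)$ with $(2s_j-1)\pi\le\operatorname{Im}E^j(z)<(2s_j+1)\pi$). $\mathcal C$ is the set of endpoints of the hairs. Fractional iterates: let $S$ be the entire solution of Schröder's equation $S(\beta z)=E(S(z))$ with $S(0)=\beta$, $S'(0)=1$; $S$ is real and strictly increasing on $\mathbb R$ and maps $\mathbb R$ bijectively onto $(\alpha,\infty)$. For $r\in\mathbb R$ define $E^r:[\alpha,\infty)\to[\alpha,\infty)$ by $E^r(\alpha)=\alpha$ and $E^r(x)=S(\beta^rS^{-1}(x))$ for $x>\alpha$, and $L^r=E^{-r}$; in particular $L(x)=E^{-1}(x)=\log x-\log\lambda$. For a gauge function $h$ (increasing, continuous, $h(t)\to0$ as $t\to0$), $\mathcal H^h$ is the Hausdorff measure: $\mathcal H^h(A)=\lim_{\delta\to0}\inf\sum_k h(\operatorname{diam}A_k)$ over countable covers of $A$ by sets of diameter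 $<\delta$. *)

(* Defs.v *)
From Stdlib Require Import Reals Lra ZArith.
Open Scope R_scope.

Definition Cx : Type := (R * R)%type.
Definition Cre (z : Cx) : R := fst z.
Definition Cim (z : Cx) : R := snd z.
Definition Cof (x : R) : Cx := (x, 0).
Definition Cadd (z w : Cx) : Cx := (fst z + fst w, snd z + snd w).
Definition Csub (z w : Cx) : Cx := (fst z - fst w, snd z - snd w).
Definition Cmul (z w : Cx) : Cx :=
  (fst z * fst w - snd z * snd w, fst z * snd w + snd z * fst w).
Definition Cabs (z : Cx) : R := sqrt (fst z * fst z + snd z * snd z).
Definition Cexp (z : Cx) : Cx := (exp (fst z) * cos (snd z), exp (fst z) * sin (snd z)).

Definition Efun (lam : R) (z : Cx) : Cx := Cmul (Cof lam) (Cexp z).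
Fixpoint Eiter (lam : R) (n : nat) (z : Cx) : Cx :=
  match n with O => z | S k => Efun lam (Eiter lam k z) end.

(* Riemann sphere = option Cx (None = infinity), chordal metric *)
Definition chordal (a b : option Cx) : R :=
  match a, b with
  | Some z, Some w => 2 * Cabs (Csub z w) /
        sqrt ((1 + Cabs z ^ 2) * (1 + Cabs w ^ 2))
  | Some z, None | None, Some z => 2 / sqrt (1 + Cabs z ^ 2)
  | None, None => 0
  end.

Definition normal_on (lam : R) (z0 : Cx) (r : R) : Prop :=
  forall phi : nat -> nat,
  exists (psi : nat -> nat) (g : Cx -> option Cx),
    (forall k, (psi k < psi (S k))%nat) /\
    forall w, Cabs (Csub w z0) < r ->
      exists rho, 0 < rho /\
        forall eps, 0 < eps -> exists K, forall k, (K <= k)%nat ->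
          forall v, Cabs (Csub v z0) < r -> Cabs (Csub v w) < rho ->
            chordal (Some (Eiter lam (phi (psi k)) v)) (g v) < eps.

Definition Julia (lam : R) (z : Cx) : Prop :=
  ~ (exists r, 0 < r /\ normal_on lam z r).

Definition in_strip (s : Z) (z : Cx) : Prop :=
  (2 * IZR s - 1) * PI <= Cim z < (2 * IZR s + 1) * PI.
Definition same_itinerary (lam : R) (z w : Cx) : Prop :=
  forall j : nat, exists s : Z,
    in_strip s (Eiter lam j z) /\ in_strip s (Eiter lam j w).

Definition hair (lam : R) (z w : Cx) : Prop :=
  Julia lam w /\ same_itinerary lam z w.

Definition endpoint (lam : R) (z : Cx) : Prop :=
  Julia lam z /\
  exists gamma : R -> Cx,
    gamma 0 = z /\
    (forall t, 0 <= t -> forall eps, 0 < eps -> exists del, 0 < del /\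
        forall t', 0 <= t' -> Rabs (t' - t) < del ->
          Cabs (Csub (gamma t') (gamma t)) < eps) /\
    (forall t t', 0 <= t -> 0 <= t' -> gamma t = gamma t' -> t = t') /\
    (forall M, exists T, forall t, T <= t -> M < Cabs (gamma t)) /\
    (forall w, hair lam z w <-> exists t, 0 <= t /\ gamma t = w).

Definition has_cderiv (f : Cx -> Cx) (z d : Cx) : Prop :=
  forall eps, 0 < eps -> exists del, 0 < del /\
    forall hh, Cabs hh < del ->
      Cabs (Csub (Csub (f (Cadd z hh)) (f z)) (Cmul d hh)) <= eps * Cabs hh.
Definition entire (f : Cx -> Cx) : Prop := forall z, exists d, has_cderiv f z d.

Definition is_diam (A : Cx -> Prop) (d : R) : Prop :=
  ((forall z, ~ A z) /\ d = 0) \/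
  is_lub (fun r => exists z w, A z /\ A w /\ r = Cabs (Csub z w)) d.

Definition Hausdorff_infinite (h : R -> R) (A : Cx -> Prop) : Prop :=
  forall M : R, exists delta, 0 < delta /\
    forall (U : nat -> Cx -> Prop) (dU : nat -> R),
      (forall k, is_diam (U k) (dU k) /\ dU k < delta) ->
      (forall z, A z -> exists k, U k z) ->
      exists N, M < sum_f_R0 (fun k => h (dU k)) N.

(* Main.v *)
(** Write [E^n(t)] for the real orbit of a large [t].  If [s_n] grows slowly enough
    relative to [E^n(t)], contraction of the inverse branches of [E] yields a point [z]
    with [E^n(z)] within [1 / E^n(t)] of [E^n(t) + 2 pi i s_n] for all [n]; such points lie
    on the hair of itinerary [s], and since [t] can be varied in both directions they are
    not endpoints.

    Take [A = S(v0)] with [v0] large, [0 <= s_n < N_n] with [N_n] about [E^n(A)], and [t] in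
    an interval of length 1 above [2 A].  Two such points at distance at most [d] have
    potentials [t] differing by [O(d)] and itineraries agreeing up to the last index [j]
    with [d |(E^j)'| <= 1/3].  So a set of diameter [d] carries at most a fraction
    [O(d / N_j)] of the family, while [1/d < E^(j+1)(5 A)].  Put
    [q = beta^((s-1)/2) > 1].  Since [S(q v) / S(v)] tends to infinity, [5 A <= S(q v0)],
    so [L^s(1/d) <= S(beta^j v0 / q)], which is negligible against
    [S(beta^j v0) = E^j(A) <= N_j].  Hence [d / N_j = o(h(d))] and a cover with bounded sum
    of [h] would have total mass less than 1. *)
From Stdlib Require Import Reals Lra Lia ZArith Ranalysis5 ClassicalEpsilon.
From Coquelicot Require Import Coquelicot.
Require Import Defs.
Open Scope R_scope.
Set Bullet Behavior "Strict Subproofs".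

(** * The complex modulus, the exponential and its inverse branches *)

(** No measure is constructed. Each set of a cover is enclosed in a box, a digit cylinder times an
    interval of potentials; if the box masses sum to less than 1, successive averaging produces
    digits and a potential outside all boxes, and a point with these data is an uncovered
    non-endpoint of the Julia set. Sets of diameter 0 cost nothing since h(0) = 0, so every set also
    receives a small summable allowance. Reality, monotonicity and growth of S on the positive axis
    are all derived from its first-order expansion at 0, carried outwards by the functional
    equation. *)

Lemma Cabs_Cmod z : Cabs z = Cmod z.
Proof. unfold Cabs, Cmod. f_equal. ring. Qed.

Lemma Cabs_ge_0 z : 0 <= Cabs z.
Proof. apply sqrt_pos. Qed.

Lemma Cabs_sqr z : Cabs z * Cabs z = fst z * fst z + snd z * snd z.
Proof. apply sqrt_sqrt. nra. Qed.

Lemma Rabs_fst_le z : Rabs (fst z) <= Cabs z.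
Proof.
  apply Rabs_le_between. pose proof (Cabs_ge_0 z). pose proof (Cabs_sqr z).
  split; nra.
Qed.

Lemma Rabs_snd_le z : Rabs (snd z) <= Cabs z.
Proof.
  apply Rabs_le_between. pose proof (Cabs_ge_0 z). pose proof (Cabs_sqr z).
  split; nra.
Qed.

Lemma Rabs_fst_sub_le a b : Rabs (fst a - fst b) <= Cabs (Csub a b).
Proof. exact (Rabs_fst_le (Csub a b)). Qed.

Lemma Rabs_snd_sub_le a b : Rabs (snd a - snd b) <= Cabs (Csub a b).
Proof. exact (Rabs_snd_le (Csub a b)). Qed.

Lemma Cabs_le_sum z : Cabs z <= Rabs (fst z) + Rabs (snd z).
Proof.
  pose proof (Cabs_sqr z). pose proof (Cabs_ge_0 z).
  pose proof (Rabs_pos (fst z)). pose proof (Rabs_pos (snd z)).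
  pose proof (Rsqr_abs (fst z)). pose proof (Rsqr_abs (snd z)).
  unfold Rsqr in *. nra.
Qed.

Lemma Csub_sym a b : Cabs (Csub a b) = Cabs (Csub b a).
Proof. unfold Cabs, Csub; simpl. f_equal. ring. Qed.

Lemma Csub_diag a : Cabs (Csub a a) = 0.
Proof.
  unfold Cabs, Csub; simpl.
  replace ((fst a - fst a) * (fst a - fst a) + (snd a - snd a) * (snd a - snd a))
    with 0 by ring. apply sqrt_0.
Qed.

Lemma Cabs_triangle a b c : Cabs (Csub a c) <= Cabs (Csub a b) + Cabs (Csub b c).
Proof.
  rewrite !Cabs_Cmod.
  replace (Csub a c) with (Cplus (Csub a b) (Csub b c)).
  - apply Cmod_triangle.
  - unfold Csub, Cplus; simpl. f_equal; ring.
Qed.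

Lemma Cabs_le_Csub a b : Cabs a <= Cabs b + Cabs (Csub a b).
Proof.
  pose proof (Cabs_triangle a b (0, 0)) as H.
  assert (forall z, Csub z (0, 0) = z) as E.
  { intros [x y]. unfold Csub; simpl. f_equal; ring. }
  rewrite !E in H. lra.
Qed.

Lemma Csub_eq_0 a b : Cabs (Csub a b) <= 0 -> a = b.
Proof.
  intros H. pose proof (Rabs_fst_le (Csub a b)). pose proof (Rabs_snd_le (Csub a b)).
  destruct a, b; unfold Csub in *; simpl in *.
  apply Rabs_le_between in H0. apply Rabs_le_between in H1. f_equal; lra.
Qed.

Lemma dot_le a b c d : a * c + b * d <= Cabs (a, b) * Cabs (c, d).
Proof.
  pose proof (Cabs_sqr (a, b)). pose proof (Cabs_sqr (c, d)).
  pose proof (Cabs_ge_0 (a, b)). pose proof (Cabs_ge_0 (c, d)). simpl in *.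
  destruct (Rle_dec (a * c + b * d) (Cabs (a, b) * Cabs (c, d))) as [|n]; auto.
  exfalso. apply Rnot_le_lt in n.
  assert (0 <= Cabs (a, b) * Cabs (c, d)) by nra.
  assert ((Cabs (a, b) * Cabs (c, d)) * (Cabs (a, b) * Cabs (c, d))
          < (a * c + b * d) * (a * c + b * d)) by nra.
  replace ((Cabs (a, b) * Cabs (c, d)) * (Cabs (a, b) * Cabs (c, d)))
    with ((Cabs (a, b) * Cabs (a, b)) * (Cabs (c, d) * Cabs (c, d))) in H4 by ring.
  rewrite H, H0 in H4. pose proof (Rle_0_sqr (a * d - b * c)). unfold Rsqr in *. lra.
Qed.

(* Vector-valued mean value inequality: project the increment on its own direction. *)
Lemma path_bound (f1 f2 g1 g2 : R -> R) (M : R) :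
  (forall t, 0 <= t <= 1 -> is_derive f1 t (g1 t)) ->
  (forall t, 0 <= t <= 1 -> is_derive f2 t (g2 t)) ->
  (forall t, 0 <= t <= 1 -> Cabs (g1 t, g2 t) <= M) ->
  Cabs (f1 1 - f1 0, f2 1 - f2 0) <= M.
Proof.
  intros D1 D2 B.
  set (c := f1 1 - f1 0). set (d := f2 1 - f2 0).
  assert (DD : forall t, 0 <= t <= 1 ->
    is_derive (fun t => c * f1 t + d * f2 t) t (c * g1 t + d * g2 t)).
  { intros t Ht.
    apply (is_derive_plus (fun t => c * f1 t) (fun t => d * f2 t));
      apply is_derive_scal; auto. }
  destruct (MVT_gen (fun t => c * f1 t + d * f2 t) 0 1 (fun t => c * g1 t + d * g2 t))
    as [x [Hx E]].
  - rewrite Rmin_left, Rmax_right by lra. intros; apply DD; lra.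
  - rewrite Rmin_left, Rmax_right by lra. intros x Hx.
    apply derivable_continuous_pt. exists (c * g1 x + d * g2 x).
    apply is_derive_Reals. apply DD; lra.
  - rewrite Rmin_left, Rmax_right in Hx by lra.
    pose proof (dot_le c d (g1 x) (g2 x)). specialize (B x Hx).
    pose proof (Cabs_sqr (c, d)). pose proof (Cabs_ge_0 (c, d)). simpl in *.
    assert (c * c + d * d = c * g1 x + d * g2 x) by (unfold c, d in *; lra).
    destruct (Rle_dec (Cabs (c, d)) M) as [|n]; auto. exfalso. apply Rnot_le_lt in n.
    pose proof (Cabs_ge_0 (g1 x, g2 x)).
    assert (0 < Cabs (c, d)) by lra.
    assert (Cabs (c, d) * Cabs (g1 x, g2 x) <= Cabs (c, d) * M)
      by (apply Rmult_le_compat_l; lra).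
    assert (Cabs (c, d) * M < Cabs (c, d) * Cabs (c, d))
      by (apply Rmult_lt_compat_l; lra). lra.
Qed.

Lemma Cabs_scale k a b : 0 <= k -> Cabs (k * a, k * b) = k * Cabs (a, b).
Proof.
  intros Hk. unfold Cabs; simpl.
  replace (k * a * (k * a) + k * b * (k * b)) with (k * k * (a * a + b * b)) by ring.
  rewrite sqrt_mult by nra. rewrite sqrt_square by lra. reflexivity.
Qed.

Lemma Efun_eq lam z :
  Efun lam z = (lam * (exp (fst z) * cos (snd z)), lam * (exp (fst z) * sin (snd z))).
Proof. unfold Efun, Cmul, Cof, Cexp; simpl. f_equal; ring. Qed.

Lemma Cabs_Efun lam z : 0 <= lam -> Cabs (Efun lam z) = lam * exp (fst z).
Proof.
  intros H. rewrite Efun_eq. pose proof (exp_pos (fst z)).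
  rewrite Cabs_scale, Cabs_scale by lra.
  unfold Cabs; simpl. pose proof (sin2_cos2 (snd z)). unfold Rsqr in *.
  replace (cos (snd z) * cos (snd z) + sin (snd z) * sin (snd z)) with 1 by lra.
  rewrite sqrt_1. ring.
Qed.

(** Mean value inequality on the segment from [b] to [a], where the real part exceeds that of [b] by
    at most the distance. The factor [Cabs (Efun lam b)] is |E'(b)|, so bounds along an orbit
    multiply to the derivative of the iterate. *)
Lemma Efun_lipschitz lam a b : 0 <= lam ->
  Cabs (Csub (Efun lam a) (Efun lam b))
    <= Cabs (Efun lam b) * (Cabs (Csub a b) * exp (Cabs (Csub a b))).
Proof.
  intros Hl. rewrite Cabs_Efun by auto. rewrite !Efun_eq.
  destruct a as [x1 y1], b as [x0 y0]. unfold Csub at 1; simpl.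
  set (dx := x1 - x0). set (dy := y1 - y0).
  set (f1 := fun t => lam * (exp (x0 + t * dx) * cos (y0 + t * dy))).
  set (f2 := fun t => lam * (exp (x0 + t * dx) * sin (y0 + t * dy))).
  set (g1 := fun t => (lam * exp (x0 + t * dx))
                      * (dx * cos (y0 + t * dy) - dy * sin (y0 + t * dy))).
  set (g2 := fun t => (lam * exp (x0 + t * dx))
                      * (dx * sin (y0 + t * dy) + dy * cos (y0 + t * dy))).
  pose proof (path_bound f1 f2 g1 g2
    (lam * exp x0 * (Cabs (Csub (x1, y1) (x0, y0)) * exp (Cabs (Csub (x1, y1) (x0, y0))))))
    as P.
  replace (lam * (exp x1 * cos y1)) with (f1 1).
  replace (lam * (exp x1 * sin y1)) with (f2 1).
  replace (lam * (exp x0 * cos y0)) with (f1 0).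
  replace (lam * (exp x0 * sin y0)) with (f2 0).
  - apply P; clear P.
    + intros t Ht. unfold f1, g1. auto_derive; auto. ring.
    + intros t Ht. unfold f2, g2. auto_derive; auto. ring.
    + intros t Ht. unfold g1, g2.
      pose proof (exp_pos (x0 + t * dx)).
      rewrite Cabs_scale by nra.
      replace (Cabs (dx * cos (y0 + t * dy) - dy * sin (y0 + t * dy),
                     dx * sin (y0 + t * dy) + dy * cos (y0 + t * dy)))
        with (Cabs (Csub (x1, y1) (x0, y0))).
      * set (D := Cabs (Csub (x1, y1) (x0, y0))).
        assert (HD : dx <= D).
        { pose proof (Rabs_fst_le (Csub (x1, y1) (x0, y0))) as Q.
          simpl in Q. apply Rabs_le_between in Q. unfold dx, D. lra. }
        assert (0 <= D) by apply Cabs_ge_0.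
        assert (exp (x0 + t * dx) <= exp x0 * exp D).
        { rewrite <- exp_plus. destruct (Req_dec (t * dx) D) as [->|]; [lra|].
          left. apply exp_increasing. nra. }
        apply Rle_trans with (lam * (exp x0 * exp D) * D); [|lra].
        apply Rmult_le_compat_r; auto. apply Rmult_le_compat_l; auto.
      * unfold Cabs, Csub; simpl. f_equal.
        pose proof (sin2_cos2 (y0 + t * dy)) as Q. unfold Rsqr in Q.
        fold dx dy. set (s := sin (y0 + t * dy)) in *. set (c := cos (y0 + t * dy)) in *.
        replace ((dx * c - dy * s) * (dx * c - dy * s) + (dx * s + dy * c) * (dx * s + dy * c))
          with ((dx * dx + dy * dy) * (s * s + c * c)) by ring.
        rewrite Q. ring.
  - unfold f2. do 3 f_equal; ring.
  - unfold f1. do 3 f_equal; ring.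
  - unfold f2, dx, dy. do 3 f_equal; ring.
  - unfold f1, dx, dy. do 3 f_equal; ring.
Qed.

(** The inverse branch on the right half-plane, with values within pi/2 of height 2 pi s; taking
    [atan] as the argument confines it to positive [fst w]. *)
Definition Lbranch (lam : R) (s : nat) (w : Cx) : Cx :=
  (/ 2 * ln (fst w * fst w + snd w * snd w) - ln lam,
   atan (snd w / fst w) + 2 * PI * INR s).

Lemma Lbranch_lipschitz lam s a b r : 0 < r -> r <= fst a -> r <= fst b ->
  Cabs (Csub (Lbranch lam s a) (Lbranch lam s b)) <= Cabs (Csub a b) / r.
Proof.
  intros Hr Ha Hb. destruct a as [x1 y1], b as [x0 y0]. simpl in Ha, Hb.
  unfold Lbranch, Csub at 1; simpl.
  set (dx := x1 - x0). set (dy := y1 - y0).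
  set (f1 := fun t => / 2 * ln ((x0 + t * dx) * (x0 + t * dx) + (y0 + t * dy) * (y0 + t * dy))).
  set (f2 := fun t => atan ((y0 + t * dy) / (x0 + t * dx))).
  set (q := fun t => (x0 + t * dx) * (x0 + t * dx) + (y0 + t * dy) * (y0 + t * dy)).
  set (g1 := fun t => (/ q t) * ((x0 + t * dx) * dx + (y0 + t * dy) * dy)).
  set (g2 := fun t => (/ q t) * ((x0 + t * dx) * dy - (y0 + t * dy) * dx)).
  assert (HX : forall t, 0 <= t <= 1 -> r <= x0 + t * dx) by (intros; unfold dx; nra).
  pose proof (path_bound f1 f2 g1 g2 (Cabs (Csub (x1, y1) (x0, y0)) / r)) as P.
  match goal with |- Cabs (?u, ?v) <= _ =>
    replace u with (f1 1 - f1 0); [replace v with (f2 1 - f2 0)|] end.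
  - apply P; clear P.
    + intros t Ht. specialize (HX t Ht). unfold f1, g1, q. auto_derive.
      * pose proof (Rle_0_sqr (y0 + t * dy)). unfold Rsqr in *. nra.
      * field. pose proof (Rle_0_sqr (y0 + t * dy)). unfold Rsqr in *. nra.
    + intros t Ht. specialize (HX t Ht). unfold f2, g2, q. auto_derive.
      * lra.
      * field. assert (0 < (x0 + t * dx) * (x0 + t * dx)) by nra.
        pose proof (Rle_0_sqr (y0 + t * dy)). unfold Rsqr in *.
        repeat split; lra.
    + intros t Ht. specialize (HX t Ht). unfold g1, g2.
      assert (Q : 0 < q t) by (unfold q; assert (0 < (x0 + t * dx) * (x0 + t * dx)) by nra;
        pose proof (Rle_0_sqr (y0 + t * dy)); unfold Rsqr in *; lra).
      pose proof (Rinv_0_lt_compat _ Q).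
      rewrite Cabs_scale by lra.
      set (D := Csub (x1, y1) (x0, y0)).
      replace (Cabs ((x0 + t * dx) * dx + (y0 + t * dy) * dy,
                     (x0 + t * dx) * dy - (y0 + t * dy) * dx))
        with (sqrt (q t) * Cabs D).
      * assert (r <= sqrt (q t)).
        { rewrite <- (sqrt_square r) by lra. apply sqrt_le_1_alt. unfold q.
          assert (r * r <= (x0 + t * dx) * (x0 + t * dx)) by (apply Rmult_le_compat; lra).
          pose proof (Rle_0_sqr (y0 + t * dy)). unfold Rsqr in *. lra. }
        pose proof (Cabs_ge_0 D).
        replace (/ q t * (sqrt (q t) * Cabs D)) with (Cabs D / sqrt (q t)).
        { unfold Rdiv. apply Rmult_le_compat_l; auto. apply Rinv_le_contravar; lra. }
        rewrite <- (sqrt_sqrt (q t)) at 2 by lra. field. lra.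
      * unfold D, Cabs, Csub, q; simpl. fold dx dy.
        pose proof (Rle_0_sqr dx). pose proof (Rle_0_sqr dy).
        unfold q, Rsqr in *. rewrite <- sqrt_mult by lra. f_equal. ring.
  - unfold f2, dx, dy.
    replace (x0 + 1 * (x1 - x0)) with x1 by ring. replace (y0 + 1 * (y1 - y0)) with y1 by ring.
    replace (x0 + 0 * (x1 - x0)) with x0 by ring. replace (y0 + 0 * (y1 - y0)) with y0 by ring.
    ring.
  - unfold f1, dx, dy.
    replace (x0 + 1 * (x1 - x0)) with x1 by ring. replace (y0 + 1 * (y1 - y0)) with y1 by ring.
    replace (x0 + 0 * (x1 - x0)) with x0 by ring. replace (y0 + 0 * (y1 - y0)) with y0 by ring.
    ring.
Qed.

Lemma Efun_Lbranch lam s w : 0 < lam -> 0 < fst w -> Efun lam (Lbranch lam s w) = w.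
Proof.
  intros Hl Hw. destruct w as [x y]. simpl in Hw.
  rewrite Efun_eq. unfold Lbranch; simpl.
  set (q := x * x + y * y). assert (Hq : 0 < q).
  { unfold q. pose proof (Rle_0_sqr y). unfold Rsqr in *. nra. }
  assert (E : lam * exp (/ 2 * ln q - ln lam) = sqrt q).
  { unfold Rminus. rewrite exp_plus, exp_Ropp, exp_ln by auto.
    rewrite <- Rpower_sqrt by auto. unfold Rpower. field. lra. }
  assert (T : sqrt (1 + (y / x)²) = sqrt q / x).
  { replace (1 + (y / x)²) with (q / (x * x)) by (unfold q, Rsqr; field; lra).
    rewrite sqrt_div by nra. rewrite sqrt_square by lra. reflexivity. }
  assert (0 < sqrt q) by (apply sqrt_lt_R0; auto).
  replace (2 * PI * INR s) with (2 * INR s * PI) by ring.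
  rewrite cos_period, sin_period, cos_atan, sin_atan, T.
  rewrite <- !Rmult_assoc, E. f_equal; field; lra.
Qed.

Lemma Lbranch_Efun lam s z : 0 < lam -> Rabs (snd z - 2 * PI * INR s) < PI / 2 ->
  Lbranch lam s (Efun lam z) = z.
Proof.
  intros Hl Hz. destruct z as [x y]. simpl in Hz. apply Rabs_def2 in Hz.
  rewrite Efun_eq. unfold Lbranch; simpl. pose proof (exp_pos x).
  set (y' := y - 2 * PI * INR s) in *.
  replace y with (y' + 2 * INR s * PI) by (unfold y'; ring).
  rewrite cos_period, sin_period.
  assert (0 < cos y') by (apply cos_gt_0; lra).
  f_equal.
  - pose proof (sin2_cos2 y') as Q. unfold Rsqr in Q.
    replace (lam * (exp x * cos y') * (lam * (exp x * cos y')) +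
             lam * (exp x * sin y') * (lam * (exp x * sin y')))
      with ((lam * exp x) * (lam * exp x) * (sin y' * sin y' + cos y' * cos y')) by ring.
    rewrite Q, Rmult_1_r. rewrite ln_mult by nra. rewrite ln_mult by nra. rewrite ln_exp.
    field.
  - replace (lam * (exp x * sin y') / (lam * (exp x * cos y'))) with (tan y').
    + rewrite atan_tan by lra. ring.
    + unfold tan. field. repeat split; lra.
Qed.

Lemma Eiter_shift lam n z : Eiter lam n (Efun lam z) = Eiter lam (S n) z.
Proof. induction n as [|n IH]; auto. simpl. rewrite IH. reflexivity. Qed.

(** * Covering a product of digit sets and an interval *)

Fixpoint sum_lt (f : nat -> R) (n : nat) : R :=
  match n with O => 0 | S m => sum_lt f m + f m end.
Fixpoint prod_lt (f : nat -> R) (n : nat) : R :=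
  match n with O => 1 | S m => prod_lt f m * f m end.

Lemma sum_lt_ext f g n : (forall i, (i < n)%nat -> f i = g i) -> sum_lt f n = sum_lt g n.
Proof.
  induction n as [|n IH]; simpl; intros H; auto.
  rewrite IH by (intros; apply H; lia). rewrite H by lia. reflexivity.
Qed.

Lemma sum_f_R0_nonneg_mono (f : nat -> R) K L :
  (forall k, 0 <= f k) -> (K <= L)%nat -> sum_f_R0 f K <= sum_f_R0 f L.
Proof.
  intros Hf H. induction H; simpl; [lra|]. pose proof (Hf (S m)). lra.
Qed.

Lemma term_le_sum (f : nat -> R) k : (forall k, 0 <= f k) -> f k <= sum_f_R0 f k.
Proof.
  intros H. destruct k; simpl; [lra|].
  pose proof (cond_pos_sum f k H). lra.
Qed.

(** Pigeonhole. If every [c] fails, each has its own partial sum above [A]; since the terms are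
    nonnegative, the largest of these lengths serves all [c] at once, and the total exceeds n A. *)
Lemma averaging (g : nat -> nat -> R) (G : nat -> R) (n : nat) (A : R) :
  (forall k c, 0 <= g k c) ->
  (0 < n)%nat ->
  (forall k, sum_lt (g k) n <= INR n * G k) ->
  (forall K, sum_f_R0 G K <= A) ->
  exists c, (c < n)%nat /\ forall K, sum_f_R0 (fun k => g k c) K <= A.
Proof.
  intros Hg Hn HG HA. apply NNPP. intros H.
  assert (B : forall c, (c < n)%nat -> exists K, A < sum_f_R0 (fun k => g k c) K).
  { intros c Hc. apply NNPP. intros H1. apply H. exists c. split; auto.
    intros K. apply Rnot_lt_le. intros H2. apply H1. exists K; auto. }
  assert (P : forall m, (m < n)%nat ->
    exists K, INR (S m) * A < sum_f_R0 (fun k => sum_lt (g k) (S m)) K).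
  { induction m as [|m IH]; intros Hm.
    - destruct (B 0%nat Hm) as [K HK]. exists K. simpl.
      rewrite (sum_eq _ (fun k => g k 0%nat)); [lra|]. intros; ring.
    - destruct IH as [K1 H1]; [lia|]. destruct (B (S m) Hm) as [K2 H2].
      exists (Nat.max K1 K2).
      assert (nn : forall k j, 0 <= sum_lt (g k) j).
      { intros k j. induction j; simpl; [lra|]. pose proof (Hg k j). lra. }
      rewrite (sum_eq _ (fun k => sum_lt (g k) (S m) + g k (S m))) by (intros; reflexivity).
      rewrite sum_plus.
      pose proof (sum_f_R0_nonneg_mono (fun k => sum_lt (g k) (S m)) K1 (Nat.max K1 K2)
        (fun k => nn k (S m)) ltac:(lia)).
      pose proof (sum_f_R0_nonneg_mono (fun k => g k (S m)) K2 (Nat.max K1 K2)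
        (fun k => Hg k (S m)) ltac:(lia)).
      rewrite (S_INR (S m)). lra. }
  destruct (P (n - 1)%nat ltac:(lia)) as [K HK].
  replace (S (n - 1)) with n in HK by lia.
  assert (sum_f_R0 (fun k => sum_lt (g k) n) K <= sum_f_R0 (fun k => INR n * G k) K)
    by (apply sum_Rle; auto).
  assert (E : sum_f_R0 (fun k => INR n * G k) K = INR n * sum_f_R0 G K).
  { rewrite scal_sum. apply sum_eq. intros; ring. }
  rewrite E in H0. pose proof (HA K). pose proof (lt_0_INR n Hn). nra.
Qed.

Definition upd (w : nat -> nat) (n c : nat) : nat -> nat :=
  fun i => if Nat.eqb i n then c else w i.

Fixpoint agree (v w : nat -> nat) (n : nat) : bool :=
  match n with O => true | S m => agree v w m && Nat.eqb (v m) (w m) end.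

Lemma agree_spec v w n : agree v w n = true <-> forall i, (i < n)%nat -> v i = w i.
Proof.
  induction n as [|n IH]; simpl; [split; auto; intros; lia|].
  rewrite Bool.andb_true_iff, IH, Nat.eqb_eq. split.
  - intros [H1 H2] i Hi. destruct (Nat.eq_dec i n); [subst; auto|]. apply H1; lia.
  - intros H. split; [intros|]; apply H; lia.
Qed.

(* Conditional probability of the cylinder [v|l] given [w|n], digit [i] uniform on
   [{0, ..., N i - 1}]. *)
Definition cyl (N : nat -> nat) (v : nat -> nat) (l n : nat) (w : nat -> nat) : R :=
  if agree v w (Nat.min n l)
  then prod_lt (fun i => INR (N i)) (Nat.min n l) / prod_lt (fun i => INR (N i)) l else 0.

Lemma prod_lt_pos (f : nat -> R) n : (forall i, 0 < f i) -> 0 < prod_lt f n.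
Proof. intros H. induction n; simpl; [lra|]. apply Rmult_lt_0_compat; auto. Qed.

Lemma cyl_nonneg N v l n w : (forall i, (0 < N i)%nat) -> 0 <= cyl N v l n w.
Proof.
  intros H. unfold cyl. destruct (agree _ _ _); [|lra].
  apply Rlt_le, Rdiv_lt_0_compat; apply prod_lt_pos; intros; apply lt_0_INR; auto.
Qed.

Lemma sum_lt_const x n : sum_lt (fun _ => x) n = INR n * x.
Proof. induction n; simpl sum_lt; [simpl; ring|]. rewrite IHn, S_INR. ring. Qed.

Lemma sum_lt_single x a n : 0 <= x ->
  sum_lt (fun c => if Nat.eqb a c then x else 0) n <= x.
Proof.
  intros Hx.
  assert (sum_lt (fun c => if Nat.eqb a c then x else 0) n <= if Nat.ltb a n then x else 0).
  { induction n; simpl; [lra|].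
    destruct (Nat.eqb_spec a n).
    - subst. rewrite Nat.ltb_irrefl in IHn.
      destruct (Nat.ltb_spec n (S n)); [lra|lia].
    - destruct (Nat.ltb_spec a n), (Nat.ltb_spec a (S n)); try lia; lra. }
  destruct (Nat.ltb a n); lra.
Qed.

(** If [l <= n], digit [n] is not examined; otherwise only [c = v n] survives, with its mass
    multiplied by [N n]. The inequality can be strict because [v n] may lie outside the digit
    range. *)
Lemma cyl_split N v l n w : (forall i, (0 < N i)%nat) ->
  sum_lt (fun c => cyl N v l (S n) (upd w n c)) (N n) <= INR (N n) * cyl N v l n w.
Proof.
  intros HN. destruct (Nat.le_gt_cases l n) as [Hl|Hl].
  - rewrite (sum_lt_ext _ (fun _ => cyl N v l n w)); [rewrite sum_lt_const; lra|].
    intros c _. unfold cyl. rewrite !Nat.min_r by lia.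
    replace (agree v (upd w n c) l) with (agree v w l); auto.
    apply Bool.eq_iff_eq_true. rewrite !agree_spec. unfold upd.
    split; intros H i Hi; specialize (H i Hi); destruct (Nat.eqb_spec i n); auto; lia.
  - unfold cyl. rewrite !Nat.min_l by lia. set (P := prod_lt (fun i => INR (N i))).
    destruct (agree v w n) eqn:A.
    + apply Rle_trans with (sum_lt (fun c => if Nat.eqb (v n) c then P (S n) / P l else 0) (N n)).
      * right. apply sum_lt_ext. intros c _.
        replace (agree v (upd w n c) (S n)) with (Nat.eqb (v n) c); auto.
        apply Bool.eq_iff_eq_true. rewrite agree_spec, Nat.eqb_eq.
        rewrite agree_spec in A. unfold upd. split.
        { intros H i Hi. destruct (Nat.eqb_spec i n); [subst; auto|]. apply A; lia. }
        { intros H. specialize (H n ltac:(lia)). rewrite Nat.eqb_refl in H. auto. }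
      * apply Rle_trans with (P (S n) / P l).
        { apply sum_lt_single. apply Rlt_le, Rdiv_lt_0_compat; apply prod_lt_pos;
            intros; apply lt_0_INR; auto. }
        right. unfold P; simpl. field.
        apply Rgt_not_eq, prod_lt_pos; intros; apply lt_0_INR; auto.
    + rewrite (sum_lt_ext _ (fun _ => 0)); [rewrite sum_lt_const; lra|].
      intros c _. replace (agree v (upd w n c) (S n)) with false; auto.
      symmetry. apply Bool.not_true_iff_false. intros H. rewrite agree_spec in H.
      apply Bool.not_true_iff_false in A. apply A. apply agree_spec.
      intros i Hi. specialize (H i ltac:(lia)). unfold upd in H.
      destruct (Nat.eqb_spec i n); auto. lia.
Qed.

Definition overlap (p q x y : R) : R := Rmax 0 (Rmin q y - Rmax p x).

Lemma overlap_split p q x m y : p <= q -> x <= m <= y ->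
  overlap p q x m + overlap p q m y = overlap p q x y.
Proof.
  intros. unfold overlap, Rmax, Rmin. repeat destruct (Rle_dec _ _); lra.
Qed.

Lemma overlap_nonneg p q x y : 0 <= overlap p q x y.
Proof. apply Rmax_l. Qed.

(* A measure-free form of "boxes covering (product of digit sets) x [a, a+1] have total
   mass at least 1": if the masses sum to less than 1, repeatedly pass to a child box on
   which the conditional masses still sum to less than 1. *)
Lemma descent (N : nat -> nat) (v : nat -> nat -> nat) (l : nat -> nat)
  (p q : nat -> R) (a A : R) :
  (forall i, (0 < N i)%nat) -> (forall k, p k <= q k) -> A < 1 ->
  (forall K, sum_f_R0 (fun k => (q k - p k) / prod_lt (fun i => INR (N i)) (l k)) K <= A) ->
  exists (w : nat -> nat) (t : R),
    (forall n, (w n < N n)%nat) /\ a <= t <= a + 1 /\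
    forall k, ~ ((forall i, (i < l k)%nat -> v k i = w i) /\ p k < t < q k).
Proof.
  intros HN Hpq HA1 HA.
  (* The conditional mass of box [k] in the current cell, a cylinder of length [n] times an interval
     of length 1/2^n; the factor 2^n normalises the length. *)
  set (g := fun n (wx : (nat -> nat) * R) k =>
    cyl N (v k) (l k) n (fst wx) *
    (2 ^ n * overlap (p k) (q k) (snd wx) (snd wx + / 2 ^ n))).
  assert (p2 : forall n, 0 < 2 ^ n) by (intros; apply pow_lt; lra).
  assert (gn : forall n wx k, 0 <= g n wx k).
  { intros n [w x] k. unfold g; simpl.
    apply Rmult_le_pos; [apply cyl_nonneg; auto|].
    apply Rmult_le_pos; [apply Rlt_le, p2|apply overlap_nonneg]. }
  set (good := fun n wx => forall K, sum_f_R0 (g n wx) K <= A).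
  assert (step : forall n wx, good n wx -> exists wx', good (S n) wx' /\
     (exists c, (c < N n)%nat /\ fst wx' = upd (fst wx) n c) /\
     snd wx <= snd wx' /\ snd wx' + / 2 ^ (S n) <= snd wx + / 2 ^ n).
  { intros n [w x] H.
    (* One step averages twice: over the next digit with the interval kept, then over the two halves
       of the interval. *)
    destruct (averaging (fun k c => cyl N (v k) (l k) (S n) (upd w n c) *
                (2 ^ n * overlap (p k) (q k) x (x + / 2 ^ n))) (g n (w, x)) (N n) A)
      as [c [Hc Hc2]]; auto.
    - intros. apply Rmult_le_pos; [apply cyl_nonneg; auto|].
      apply Rmult_le_pos; [apply Rlt_le, p2|apply overlap_nonneg].
    - intros k. unfold g; simpl. set (o := 2 ^ n * _).
      assert (0 <= o) by (apply Rmult_le_pos; [apply Rlt_le, p2|apply overlap_nonneg]).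
      pose proof (cyl_split N (v k) (l k) n w HN).
      assert (E : forall f m, sum_lt (fun c => f c * o) m = sum_lt f m * o).
      { intros f m. induction m; simpl; [ring|]. rewrite IHm. ring. }
      rewrite E. nra.
    - destruct (averaging (fun k e => g (S n) (upd w n c, x + INR e * / 2 ^ (S n)) k)
        (fun k => cyl N (v k) (l k) (S n) (upd w n c) *
                (2 ^ n * overlap (p k) (q k) x (x + / 2 ^ n))) 2%nat A) as [c2 [Hc2' Hc3]];
        auto.
      + intros k. unfold g. simpl sum_lt. simpl fst. simpl snd.
        set (y := cyl _ _ _ _ _).
        rewrite <- (overlap_split (p k) (q k) x (x + / 2 ^ (S n)) (x + / 2 ^ n)).
        * right. simpl INR. change (2 ^ S n) with (2 * 2 ^ n).
          replace (x + 0 * / (2 * 2 ^ n)) with x by ring.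
          replace (x + 1 * / (2 * 2 ^ n)) with (x + / (2 * 2 ^ n)) by ring.
          replace (x + / (2 * 2 ^ n) + / (2 * 2 ^ n)) with (x + / 2 ^ n).
          { ring. }
          pose proof (p2 n). simpl. field. lra.
        * auto.
        * pose proof (p2 n). assert (/ 2 ^ n = / 2 ^ S n + / 2 ^ S n) by (simpl; field; lra).
          pose proof (Rinv_0_lt_compat _ (p2 (S n))). lra.
      + exists (upd w n c, x + INR c2 * / 2 ^ (S n)).
        split; [exact Hc3|]. split; [exists c; auto|].
        change (x <= x + INR c2 * / 2 ^ S n /\ x + INR c2 * / 2 ^ S n + / 2 ^ S n <= x + / 2 ^ n).
        pose proof (p2 n). assert (/ 2 ^ n = / 2 ^ S n + / 2 ^ S n) by (simpl; field; lra).
        pose proof (Rinv_0_lt_compat _ (p2 (S n))).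
        pose proof (pos_INR c2). assert (INR c2 <= 1) by (apply (le_INR c2 1); lia).
        split; nra. }
  set (next := fun n (s : {wx | good n wx}) =>
    constructive_indefinite_description _ (step n (proj1_sig s) (proj2_sig s))).
  assert (g0 : good 0%nat (fun _ => 0%nat, a)).
  { intros K. eapply Rle_trans; [|apply (HA K)]. apply sum_Rle. intros k _.
    unfold g, cyl, overlap; simpl.
    assert (0 < prod_lt (fun i => INR (N i)) (l k))
      by (apply prod_lt_pos; intros; apply lt_0_INR; auto).
    unfold agree; simpl. unfold Rdiv. rewrite Rmult_1_l, Rmult_comm.
    apply Rmult_le_compat_r; [apply Rlt_le, Rinv_0_lt_compat; auto|].
    pose proof (Hpq k). unfold Rmax, Rmin. repeat destruct (Rle_dec _ _); lra. }
  set (st := fix st n : {wx | good n wx} :=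
    match n with
    | O => exist _ _ g0
    | S m => exist _ (proj1_sig (next m (st m))) (proj1 (proj2_sig (next m (st m))))
    end).
  set (W := fun n => fst (proj1_sig (st n))). set (X := fun n => snd (proj1_sig (st n))).
  assert (SW : forall n, exists c, (c < N n)%nat /\ W (S n) = upd (W n) n c).
  { intros n. exact (proj1 (proj2 (proj2_sig (next n (st n))))). }
  assert (SX : forall n, X n <= X (S n) /\ X (S n) + / 2 ^ (S n) <= X n + / 2 ^ n).
  { intros n. exact (proj2 (proj2 (proj2_sig (next n (st n))))). }
  assert (SG : forall n, good n (W n, X n)).
  { intros n. unfold W, X. rewrite <- surjective_pairing. exact (proj2_sig (st n)). }
  assert (X0 : X 0%nat = a) by reflexivity.
  clearbody W X. clear st next g0 step.
  assert (mono : forall n m, X n <= X (n + m)%nat /\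
                   X (n + m)%nat + / 2 ^ (n + m) <= X n + / 2 ^ n).
  { intros n m. induction m as [|m [I1 I2]].
    - rewrite Nat.add_0_r. lra.
    - rewrite Nat.add_succ_r. destruct (SX (n + m)%nat). lra. }
  assert (ip2 : forall n, 0 < / 2 ^ n) by (intros; apply Rinv_0_lt_compat, p2).
  destruct (completeness (fun x => exists n, x = X n)) as [t [ub lub]].
  { exists (a + 1). intros y [n ->]. destruct (mono 0%nat n) as [_ Q]. simpl in Q.
    pose proof (ip2 n). rewrite X0 in Q. lra. }
  { exists a, 0%nat. auto. }
  assert (tX : forall n, X n <= t <= X n + / 2 ^ n).
  { intros n. split; [apply ub; eauto|]. apply lub. intros y [m ->].
    destruct (Nat.le_gt_cases n m).
    - destruct (mono n (m - n)%nat) as [_ Q].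
      replace (n + (m - n))%nat with m in Q by lia. pose proof (ip2 m). lra.
    - destruct (mono m (n - m)%nat) as [Q _].
      replace (m + (n - m))%nat with n in Q by lia. pose proof (ip2 n). lra. }
  assert (WW : forall n m i, (i < n)%nat -> W (n + m)%nat i = W n i).
  { intros n m i Hi. induction m; [rewrite Nat.add_0_r; auto|].
    rewrite Nat.add_succ_r. destruct (SW (n + m)%nat) as [c [_ ->]]. unfold upd.
    destruct (Nat.eqb_spec i (n + m)); [lia|auto]. }
  exists (fun n => W (S n) n), t. split; [|split].
  - intros n. destruct (SW n) as [c [Hc ->]]. unfold upd. rewrite Nat.eqb_refl. auto.
  - specialize (tX 0%nat). rewrite X0 in tX. simpl in tX. lra.
  - intros k [Hv Ht].
    destruct (pow_lt_1_zero (/ 2) ltac:(rewrite Rabs_pos_eq; lra)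
      (Rmin (t - p k) (q k - t)) ltac:(apply Rmin_pos; lra)) as [n0 Hn0].
    set (n := Nat.max n0 (l k)). specialize (Hn0 n ltac:(lia)).
    rewrite pow_inv in Hn0. rewrite Rabs_pos_eq in Hn0 by (apply Rlt_le, ip2).
    (* If the limit point were in the open box [k], this late cell would lie wholly inside it, with
       conditional mass 1 > A. *)
    assert (G1 : g n (W n, X n) k = 1).
    { unfold g, cyl; simpl. rewrite Nat.min_r by lia.
      replace (agree (v k) (W n) (l k)) with true.
      - assert (0 < prod_lt (fun i => INR (N i)) (l k))
          by (apply prod_lt_pos; intros; apply lt_0_INR; auto).
        pose proof (Rmin_l (t - p k) (q k - t)). pose proof (Rmin_r (t - p k) (q k - t)).
        pose proof (tX n). pose proof (p2 n).
        unfold overlap. rewrite Rmin_right, Rmax_right, Rmax_right; try lra.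
        + field. lra.
        + rewrite Rmax_right by lra. pose proof (ip2 n). lra.
      - symmetry. apply agree_spec. intros i Hi. rewrite Hv by auto.
        symmetry. replace n with (S i + (n - S i))%nat by lia. apply WW. lia. }
    pose proof (SG n k). pose proof (term_le_sum (g n (W n, X n)) k (gn n _)). lra.
Qed.

(** * Orbits with prescribed itinerary *)

Fixpoint Er (lam : R) (n : nat) (t : R) : R :=
  match n with O => t | S m => lam * exp (Er lam m t) end.

Lemma Er_shift lam n t : Er lam n (lam * exp t) = Er lam (S n) t.
Proof. induction n as [|n IH]; auto. simpl. rewrite IH. reflexivity. Qed.

Definition shift (s : nat -> nat) : nat -> nat := fun n => s (S n).

(** The bound 20 keeps every tracking error 1/E^n(t) at most 1/20, the slack behind the later
    numerical constants. *)
Definition doubling (lam T : R) : Prop := 20 <= T /\ forall x, T <= x -> 2 * x <= lam * exp x.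

Lemma exp_ge_sqr x : 0 <= x -> x * x / 4 <= exp x.
Proof.
  intros H. pose proof (exp_ineq1_le (x / 2)).
  replace x with (x / 2 + x / 2) at 3 by field. rewrite exp_plus. nra.
Qed.

Lemma exp_le_compat x y : x <= y -> exp x <= exp y.
Proof. intros [H| ->]; [left; apply exp_increasing; auto|lra]. Qed.

Lemma doubling_exists lam : 0 < lam -> exists T, doubling lam T.
Proof.
  intros Hl. exists (20 + 8 / lam).
  assert (0 < 8 / lam) by (apply Rdiv_lt_0_compat; lra).
  split; [lra|]. intros x Hx.
  pose proof (exp_ge_sqr x ltac:(lra)).
  apply Rle_trans with (lam * (x * x / 4)); [|apply Rmult_le_compat_l; lra].
  assert (8 <= lam * x).
  { replace 8 with (lam * (8 / lam)) by (field; lra). apply Rmult_le_compat_l; lra. }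
  nra.
Qed.

Lemma Er_ge lam T t n : doubling lam T -> T <= t -> 2 ^ n * t <= Er lam n t.
Proof.
  intros [H1 H2] Ht. induction n as [|n IH]; simpl; [lra|].
  assert (1 <= 2 ^ n) by (apply pow_R1_Rle; lra).
  assert (T <= Er lam n t) by nra.
  pose proof (H2 _ H0). lra.
Qed.

Lemma Er_ge_T lam T t n : doubling lam T -> T <= t -> T <= Er lam n t.
Proof.
  intros H Ht. pose proof (Er_ge lam T t n H Ht). destruct H.
  assert (1 <= 2 ^ n) by (apply pow_R1_Rle; lra). nra.
Qed.

Lemma Er_monotone lam n t t' : 0 <= lam -> t <= t' -> Er lam n t <= Er lam n t'.
Proof.
  intros Hl H. induction n; simpl; auto. apply Rmult_le_compat_l; auto.
  apply exp_le_compat; auto.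
Qed.

(* Itineraries growing slowly enough relative to the real orbit of [t] to be
   shadowed by an actual orbit, with error [1 / E^n t] at time [n]. *)
Definition adm (lam T : R) (s : nat -> nat) (t : R) : Prop :=
  T <= t /\
  forall n, (2 * PI * INR (s (S n)) + 1) * Er lam n t <= Er lam (S n) t - 1.

Lemma adm_shift lam T s t :
  doubling lam T -> adm lam T s t -> adm lam T (shift s) (lam * exp t).
Proof.
  intros D [H1 H2]. split.
  - apply (Er_ge_T lam T t 1 D H1).
  - intros n. rewrite !Er_shift. apply H2.
Qed.

Definition tracks (lam : R) (s : nat -> nat) (t : R) (z : Cx) : Prop :=
  forall n, Cabs (Csub (Eiter lam n z) (Er lam n t, 2 * PI * INR (s n))) <= / Er lam n t.

Lemma tracks_shift lam s t z :
  tracks lam s t z -> tracks lam (shift s) (lam * exp t) (Efun lam z).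
Proof. intros H n. rewrite Er_shift, Eiter_shift. apply H. Qed.

(** For admissible data, the point whose [n]-th image is E^n(t) + 2 pi i s_n, obtained by pulling
    back along the branches that the digits prescribe. *)
Fixpoint approx (lam : R) (n : nat) (s : nat -> nat) (t : R) : Cx :=
  match n with
  | O => (t, 2 * PI * INR (s 0%nat))
  | S m => Lbranch lam (s 0%nat) (approx lam m (shift s) (lam * exp t))
  end.

Lemma Efun_real_center lam s t : Efun lam (t, 2 * PI * INR s) = (lam * exp t, 0).
Proof.
  rewrite Efun_eq; simpl.
  replace (2 * PI * INR s) with (0 + 2 * INR s * PI) by ring.
  rewrite cos_period, sin_period, cos_0, sin_0. f_equal; ring.
Qed.

Lemma Lbranch_center lam s t : 0 < lam -> Lbranch lam s (lam * exp t, 0) = (t, 2 * PI * INR s).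
Proof.
  intros Hl. rewrite <- (Efun_real_center lam s t). apply Lbranch_Efun; auto. simpl.
  replace (2 * PI * INR s - 2 * PI * INR s) with 0 by ring. rewrite Rabs_R0.
  pose proof PI_RGT_0. lra.
Qed.

(** By induction the shifted approximant is within 1 of E(t) + 2 pi i s_1, hence within 1 + 2 pi s_1
    of E(t), whose preimage is the center. The branch contracts by 1/(E(t) - 1), and [adm] at index
    0 says exactly that the resulting quotient is at most 1/t. *)
Lemma approx_close lam T n : 0 < lam -> doubling lam T -> forall s t, adm lam T s t ->
  Cabs (Csub (approx lam n s t) (t, 2 * PI * INR (s 0%nat))) <= / t.
Proof.
  intros Hl D. pose proof PI_RGT_0 as PI0.
  induction n as [|n IH]; intros s t A; assert (HT := proj1 A); assert (D1 := proj1 D).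
  - simpl. rewrite Csub_diag. apply Rlt_le, Rinv_0_lt_compat. lra.
  - simpl. rewrite <- (Lbranch_center lam (s 0%nat) t) by auto.
    specialize (IH _ _ (adm_shift _ _ _ _ D A)).
    pose proof (Er_ge_T lam T t 1 D HT) as HT1. simpl in HT1.
    pose proof (proj2 A 0%nat) as A0. simpl in A0.
    set (w := approx lam n (shift s) (lam * exp t)) in *.
    set (X := lam * exp t) in *.
    assert (iX : / X <= 1) by (rewrite <- Rinv_1; apply Rinv_le_contravar; lra).
    change (INR (shift s 0%nat)) with (INR (s 1%nat)) in IH.
    set (y := 2 * PI * INR (s 1%nat)) in *.
    assert (0 <= y) by (unfold y; pose proof (pos_INR (s 1%nat)); nra).
    assert (F : X - 1 <= fst w).
    { pose proof (Rabs_fst_le (Csub w (X, y))) as Q. simpl in Q.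
      apply Rabs_le_between in Q. lra. }
    eapply Rle_trans;
      [apply Lbranch_lipschitz with (r := X - 1); simpl; lra|].
    assert (Cabs (Csub w (X, 0)) <= 1 + y).
    { eapply Rle_trans; [apply (Cabs_triangle _ (X, y))|].
      apply Rplus_le_compat; [lra|].
      eapply Rle_trans; [apply Cabs_le_sum|]. unfold Csub; simpl.
      rewrite Rminus_diag, Rabs_R0, Rminus_0_r, Rabs_pos_eq; lra. }
    apply Rle_trans with ((1 + y) / (X - 1)).
    + unfold Rdiv. apply Rmult_le_compat_r; auto. apply Rlt_le, Rinv_0_lt_compat. lra.
    + apply (Rmult_le_reg_r ((X - 1) * t)); [apply Rmult_lt_0_compat; lra|].
      replace ((1 + y) / (X - 1) * ((X - 1) * t)) with ((1 + y) * t) by (field; lra).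
      replace (/ t * ((X - 1) * t)) with (X - 1) by (field; lra). lra.
Qed.

Lemma approx_fst_ge lam T n s t : 0 < lam -> doubling lam T -> adm lam T s t ->
  t - 1 <= fst (approx lam n s t).
Proof.
  intros Hl D A. pose proof (approx_close lam T n Hl D s t A).
  pose proof (Rabs_fst_le (Csub (approx lam n s t) (t, 2 * PI * INR (s 0%nat)))) as Q.
  simpl in Q. apply Rabs_le_between in Q.
  assert (/ t <= 1).
  { destruct D, A. rewrite <- Rinv_1. apply Rinv_le_contravar; lra. }
  lra.
Qed.

(** The innermost discrepancy is at most 1, and each branch applied to it at least halves it, the
    real parts being at least 2. *)
Lemma approx_cauchy lam T n : 0 < lam -> doubling lam T -> forall s t, adm lam T s t ->
  Cabs (Csub (approx lam (S n) s t) (approx lam n s t)) <= / 2 ^ n.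
Proof.
  intros Hl D. assert (D1 := proj1 D).
  induction n as [|n IH]; intros s t A; assert (HT := proj1 A).
  - eapply Rle_trans; [apply (approx_close lam T 1 Hl D s t A)|].
    simpl. rewrite Rinv_1, <- Rinv_1. apply Rinv_le_contravar; lra.
  - pose proof (adm_shift _ _ _ _ D A) as A'. specialize (IH _ _ A').
    pose proof (approx_fst_ge lam T n _ _ Hl D A').
    pose proof (approx_fst_ge lam T (S n) _ _ Hl D A'). destruct A' as [HT' _].
    change (Cabs (Csub (Lbranch lam (s 0%nat) (approx lam (S n) (shift s) (lam * exp t)))
                       (Lbranch lam (s 0%nat) (approx lam n (shift s) (lam * exp t))))
            <= / 2 ^ S n).
    eapply Rle_trans; [apply Lbranch_lipschitz with (r := 2); lra|].
    assert (0 < 2 ^ n) by (apply pow_lt; lra).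
    change (2 ^ S n) with (2 * 2 ^ n). rewrite Rinv_mult. lra.
Qed.

Lemma geometric_limit (x : nat -> R) :
  (forall n, Rabs (x (S n) - x n) <= / 2 ^ n) ->
  exists l, forall n, Rabs (x n - l) <= 2 / 2 ^ n.
Proof.
  intros H.
  assert (p2 : forall n, 0 < / 2 ^ n) by (intros; apply Rinv_0_lt_compat, pow_lt; lra).
  assert (half : forall n, / 2 ^ n = 2 * / 2 ^ S n).
  { intros. assert (0 < 2 ^ n) by (apply pow_lt; lra). simpl. field. lra. }
  assert (M : forall n m, x n - 2 * / 2 ^ n <= x (n + m)%nat - 2 * / 2 ^ (n + m) /\
                          x (n + m)%nat + 2 * / 2 ^ (n + m) <= x n + 2 * / 2 ^ n).
  { intros n m. induction m as [|m IH]; [rewrite Nat.add_0_r; lra|].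
    rewrite Nat.add_succ_r. pose proof (H (n + m)%nat) as Q.
    apply Rabs_le_between in Q. rewrite (half (n + m)%nat) in *. lra. }
  assert (B : forall n m, x n - 2 * / 2 ^ n <= x m + 2 * / 2 ^ m).
  { intros n m. pose proof (p2 n). pose proof (p2 m). destruct (Nat.le_gt_cases n m).
    - destruct (M n (m - n)%nat) as [Q _]. replace (n + (m - n))%nat with m in Q by lia. lra.
    - destruct (M m (n - m)%nat) as [_ Q]. replace (m + (n - m))%nat with n in Q by lia. lra. }
  destruct (completeness (fun y => exists n, y = x n - 2 * / 2 ^ n)) as [l [ub lub]].
  - exists (x 0%nat + 2 * / 2 ^ 0). intros y [n ->]. apply B.
  - exists (x 0%nat - 2 * / 2 ^ 0). exists 0%nat. auto.
  - exists l. intros n. apply Rabs_le_between. unfold Rdiv.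
    assert (x n - 2 * / 2 ^ n <= l) by (apply ub; eauto).
    assert (l <= x n + 2 * / 2 ^ n) by (apply lub; intros y [m ->]; apply B).
    lra.
Qed.

Lemma le_of_geometric x y C : 0 <= C -> (forall n, x <= y + C / 2 ^ n) -> x <= y.
Proof.
  intros HC H. apply Rnot_lt_le. intros L.
  destruct (pow_lt_1_zero (/ 2) ltac:(rewrite Rabs_pos_eq; lra) ((x - y) / (C + 1))) as [n Hn].
  { apply Rdiv_lt_0_compat; lra. }
  specialize (Hn n ltac:(lia)). rewrite pow_inv in Hn.
  assert (0 < / 2 ^ n) by (apply Rinv_0_lt_compat, pow_lt; lra).
  rewrite Rabs_pos_eq in Hn by lra. specialize (H n). unfold Rdiv in H.
  apply (Rmult_lt_compat_r (C + 1)) in Hn; [|lra].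
  replace ((x - y) / (C + 1) * (C + 1)) with (x - y) in Hn by (field; lra). nra.
Qed.

Definition hairpoint (lam : R) (s : nat -> nat) (t : R) (z : Cx) : Prop :=
  forall n, Cabs (Csub (approx lam n s t) z) <= 4 / 2 ^ n.

Lemma hairpoint_exists lam T s t : 0 < lam -> doubling lam T -> adm lam T s t ->
  exists z, hairpoint lam s t z.
Proof.
  intros Hl D A.
  destruct (geometric_limit (fun n => fst (approx lam n s t))) as [x Hx].
  { intros n. eapply Rle_trans; [|apply (approx_cauchy lam T n Hl D s t A)].
    apply (Rabs_fst_le (Csub (approx lam (S n) s t) (approx lam n s t))). }
  destruct (geometric_limit (fun n => snd (approx lam n s t))) as [y Hy].
  { intros n. eapply Rle_trans; [|apply (approx_cauchy lam T n Hl D s t A)].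
    apply (Rabs_snd_le (Csub (approx lam (S n) s t) (approx lam n s t))). }
  exists (x, y). intros n. eapply Rle_trans; [apply Cabs_le_sum|]. simpl.
  specialize (Hx n). specialize (Hy n). simpl in *. lra.
Qed.

(** [approx n] of the shifted data is the image of [approx (S n)], so by continuity of E both points
    are limits of one sequence. This reduces tracking at time [n] to time 0. *)
Lemma hairpoint_shift lam T s t z : 0 < lam -> doubling lam T -> adm lam T s t ->
  hairpoint lam s t z -> hairpoint lam (shift s) (lam * exp t) (Efun lam z).
Proof.
  intros Hl D A Hz. pose proof (adm_shift _ _ _ _ D A) as A'.
  destruct (hairpoint_exists lam T _ _ Hl D A') as [z' Hz'].
  replace (Efun lam z) with z'; auto. symmetry. apply Csub_eq_0.
  set (C := Cabs (Efun lam z) * exp 4).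
  assert (HC : 0 <= C).
  { apply Rmult_le_pos; [apply Cabs_ge_0|left; apply exp_pos]. }
  apply (le_of_geometric _ _ (4 * C + 4)); [lra|]. intros n.
  eapply Rle_trans; [apply (Cabs_triangle _ (approx lam n (shift s) (lam * exp t)))|].
  assert (E : approx lam n (shift s) (lam * exp t) = Efun lam (approx lam (S n) s t)).
  { simpl. rewrite Efun_Lbranch; auto.
    pose proof (approx_fst_ge lam T n _ _ Hl D A'). destruct A', D. lra. }
  pose proof (Hz' n). rewrite E at 1.
  pose proof (Efun_lipschitz lam (approx lam (S n) s t) z ltac:(lra)) as L.
  rewrite Csub_sym.
  pose proof (Hz (S n)) as H1.
  set (d := Cabs (Csub (approx lam (S n) s t) z)) in *.
  assert (0 < 2 ^ n) by (apply pow_lt; lra).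
  assert (1 <= 2 ^ n) by (apply pow_R1_Rle; lra).
  assert (i2 : 0 < / 2 ^ n <= 1).
  { split; [apply Rinv_0_lt_compat; auto|]. rewrite <- Rinv_1. apply Rinv_le_contravar; lra. }
  assert (dle : d <= 4 / 2 ^ n).
  { eapply Rle_trans; [apply H1|]. unfold Rdiv. simpl. rewrite Rinv_mult. lra. }
  assert (0 <= d) by apply Cabs_ge_0.
  assert (exp d <= exp 4) by (apply exp_le_compat; unfold Rdiv in dle; lra).
  assert (Cabs (Efun lam z) * (d * exp d) <= C * (4 / 2 ^ n)).
  { unfold C. rewrite Rmult_assoc. apply Rmult_le_compat_l; [apply Cabs_ge_0|].
    rewrite Rmult_comm. apply Rmult_le_compat; auto. left; apply exp_pos. }
  unfold Rdiv in *. lra.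
Qed.

Lemma hairpoint_tracks lam T s t z : 0 < lam -> doubling lam T -> adm lam T s t ->
  hairpoint lam s t z -> tracks lam s t z.
Proof.
  intros Hl D A Hz n. revert s t z A Hz. induction n as [|n IH]; intros s t z A Hz.
  - simpl. apply (le_of_geometric _ _ 4); [lra|]. intros n.
    eapply Rle_trans; [apply (Cabs_triangle _ (approx lam n s t))|].
    pose proof (approx_close lam T n Hl D s t A). specialize (Hz n).
    rewrite Csub_sym in Hz. lra.
  - rewrite <- Er_shift, <- Eiter_shift. apply (IH (shift s)).
    + apply adm_shift; auto.
    + eapply hairpoint_shift; eauto.
Qed.

Lemma tracks_exists lam T s t : 0 < lam -> doubling lam T -> adm lam T s t ->
  exists z, tracks lam s t z.
Proof.
  intros Hl D A. destruct (hairpoint_exists lam T s t Hl D A) as [z Hz].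
  exists z. eapply hairpoint_tracks; eauto.
Qed.

Lemma tracks_fst lam T s t z n : doubling lam T -> T <= t -> tracks lam s t z ->
  Rabs (fst (Eiter lam n z) - Er lam n t) <= / Er lam n t /\ / Er lam n t <= / 20.
Proof.
  intros D HT H. specialize (H n). split.
  - pose proof (Rabs_fst_le (Csub (Eiter lam n z) (Er lam n t, 2 * PI * INR (s n)))) as Q.
    simpl in Q. lra.
  - pose proof (Er_ge_T lam T t n D HT). destruct D. apply Rinv_le_contravar; lra.
Qed.

Lemma tracks_snd lam T s t z n : doubling lam T -> T <= t -> tracks lam s t z ->
  Rabs (snd (Eiter lam n z) - 2 * PI * INR (s n)) <= / 20.
Proof.
  intros D HT H.
  pose proof (Rabs_snd_le (Csub (Eiter lam n z) (Er lam n t, 2 * PI * INR (s n)))) as Q.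
  simpl in Q. pose proof (proj2 (tracks_fst lam T s t z n D HT H)). specialize (H n). lra.
Qed.

(** On the disc of radius 8 about E(z) real parts stay at least 2, so the branch halves distances.
    Radius 8 suits both applications: a vertical move by pi, and two points of one strip, whose
    heights differ by less than 2 pi. *)
Lemma branch_step lam T s t z w : 0 < lam -> doubling lam T -> T <= t ->
  tracks lam s t z -> Cabs (Csub w (Efun lam z)) <= 8 ->
  2 <= fst w /\
  Cabs (Csub (Lbranch lam (s 0%nat) w) z) <= Cabs (Csub w (Efun lam z)) / 2.
Proof.
  intros Hl D HT H Hw. pose proof PI_RGT_0. pose proof PI2_3_2.
  destruct (tracks_fst lam T s t z 1 D HT H) as [F1 F2].
  pose proof (tracks_snd lam T s t z 0 D HT H) as F3.
  pose proof (Er_ge_T lam T t 1 D HT). destruct D as [D _].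
  change (Eiter lam 1 z) with (Efun lam z) in F1. change (Eiter lam 0 z) with z in F3.
  apply Rabs_le_between in F1.
  pose proof (Rabs_fst_sub_le w (Efun lam z)) as Q. apply Rabs_le_between in Q.
  split; [lra|].
  rewrite <- (Lbranch_Efun lam (s 0%nat) z) at 1 by (auto; lra).
  apply Lbranch_lipschitz; lra.
Qed.

Lemma pullback lam T n : 0 < lam -> doubling lam T ->
  forall s t z w, adm lam T s t -> tracks lam s t z ->
  Cabs (Csub w (Eiter lam n z)) <= 8 ->
  exists v, Eiter lam n v = w /\ Cabs (Csub v z) <= 8 / 2 ^ n.
Proof.
  intros Hl D. induction n as [|n IH]; intros s t z w A H Hw.
  - exists w. simpl in *. split; auto. lra.
  - rewrite <- Eiter_shift in Hw.
    destruct (IH _ _ _ w (adm_shift _ _ _ _ D A) (tracks_shift _ _ _ _ H) Hw) as [v [E Hv]].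
    assert (8 / 2 ^ n <= 8).
    { assert (1 <= 2 ^ n) by (apply pow_R1_Rle; lra).
      apply (Rmult_le_reg_r (2 ^ n)); [lra|]. unfold Rdiv.
      rewrite Rmult_assoc, Rinv_l by lra. lra. }
    destruct (branch_step lam T s t z v Hl D (proj1 A) H ltac:(lra)) as [B1 B2].
    exists (Lbranch lam (s 0%nat) v). split.
    + rewrite <- Eiter_shift, Efun_Lbranch by lra. exact E.
    + simpl. assert (0 < 2 ^ n) by (apply pow_lt; lra).
      replace (8 / (2 * 2 ^ n)) with (8 / 2 ^ n / 2) by (field; lra). lra.
Qed.

(** A positive real part of the image makes the cosine of the height positive, which leaves only the
    middle half of the strip, where the branch inverts [Efun]. *)
Lemma Lbranch_Efun_strip lam s v : 0 < lam -> in_strip (Z.of_nat s) v -> 0 < fst (Efun lam v) ->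
  Lbranch lam s (Efun lam v) = v.
Proof.
  intros Hl [H1 H2] Hp. rewrite <- INR_IZR_INZ in *. rewrite Efun_eq in Hp; simpl in Hp.
  assert (C : 0 < cos (Cim v - 2 * PI * INR s)).
  { unfold Cim. replace (snd v) with (snd v - 2 * PI * INR s + 2 * INR s * PI) in Hp by ring.
    rewrite cos_period in Hp. pose proof (exp_pos (fst v)).
    set (c := cos _) in *. apply Rnot_le_lt. intros Hc.
    assert (exp (fst v) * c <= 0) by nra. nra. }
  apply Lbranch_Efun; auto. fold (Cim v).
  assert (forall y, - PI <= y <= PI -> 0 < cos y -> y < PI / 2) as K.
  { intros y Hy Hc. apply Rnot_le_lt. intros L. pose proof PI_RGT_0.
    pose proof (cos_le_0 y L ltac:(lra)). lra. }
  apply Rabs_def1.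
  - apply K; auto. lra.
  - apply Ropp_lt_cancel. rewrite Ropp_involutive. apply K; [lra|]. rewrite cos_neg. auto.
Qed.

(** Counterpart of [pullback]: the itinerary of [v] identifies [v] as the branch pullback of its own
    images, so the contraction applies to [v] itself. *)
Lemma same_itinerary_close lam T n : 0 < lam -> doubling lam T ->
  forall s t z v, adm lam T s t -> tracks lam s t z ->
  (forall j, in_strip (Z.of_nat (s j)) (Eiter lam j v)) ->
  Cabs (Csub (Eiter lam n v) (Eiter lam n z)) <= 8 ->
  Cabs (Csub v z) <= 8 / 2 ^ n.
Proof.
  intros Hl D. induction n as [|n IH]; intros s t z v A H Hs Hv.
  - simpl in *. lra.
  - rewrite <- !Eiter_shift in Hv.
    assert (I := IH _ _ _ (Efun lam v) (adm_shift _ _ _ _ D A) (tracks_shift _ _ _ _ H)).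
    assert (I2 : Cabs (Csub (Efun lam v) (Efun lam z)) <= 8 / 2 ^ n).
    { apply I; auto. intros j. rewrite Eiter_shift. apply (Hs (S j)). }
    assert (1 <= 2 ^ n) by (apply pow_R1_Rle; lra).
    assert (8 / 2 ^ n <= 8).
    { apply (Rmult_le_reg_r (2 ^ n)); [lra|]. unfold Rdiv.
      rewrite Rmult_assoc, Rinv_l by lra. lra. }
    destruct (branch_step lam T s t z (Efun lam v) Hl D (proj1 A) H ltac:(lra)) as [B1 B2].
    rewrite Lbranch_Efun_strip in B2; [|assumption|apply (Hs 0%nat)|lra].
    simpl. replace (8 / (2 * 2 ^ n)) with (8 / 2 ^ n / 2) by (field; lra). lra.
Qed.

(** * Julia set and endpoints *)

(** A scalar test function on the sphere, 1-Lipschitz for the chordal metric; limits of iterates are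
    compared through it, so no triangle inequality for [chordal] enters. *)
Definition height (a : option Cx) : R :=
  match a with Some z => / (1 + Cabs z ^ 2) | None => 0 end.

(** For finite points of moduli p and q the difference is (q - p)(p + q) / ((1 + p^2)(1 + q^2)), and
    (1 + p^2)(1 + q^2) = (p + q)^2 + (1 - p q)^2 bounds p + q by the square root of the
    denominator. *)
Lemma height_chordal a b : Rabs (height a - height b) <= chordal a b.
Proof.
  assert (N : forall z, Rabs (/ (1 + Cabs z ^ 2)) <= 2 / sqrt (1 + Cabs z ^ 2)).
  { intros z. set (A := 1 + Cabs z ^ 2).
    assert (1 <= A) by (unfold A; pose proof (pow2_ge_0 (Cabs z)); lra).
    assert (1 <= sqrt A) by (rewrite <- sqrt_1; apply sqrt_le_1_alt; auto).
    rewrite Rabs_pos_eq by (left; apply Rinv_0_lt_compat; lra).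
    rewrite <- (sqrt_sqrt A) at 1 by lra.
    apply (Rmult_le_reg_r (sqrt A * sqrt A)); [nra|].
    replace (2 / sqrt A * (sqrt A * sqrt A)) with (2 * sqrt A) by (field; lra).
    rewrite Rinv_l by nra. lra. }
  destruct a as [z|], b as [w|]; simpl height; simpl chordal.
  - pose proof (Cabs_le_Csub z w) as T1. pose proof (Cabs_le_Csub w z) as T2.
    rewrite Csub_sym in T2.
    set (D := Cabs (Csub z w)) in *. set (p := Cabs z) in *. set (q := Cabs w) in *.
    assert (Hp : 0 <= p) by apply Cabs_ge_0. assert (Hq : 0 <= q) by apply Cabs_ge_0.
    assert (HD : 0 <= D) by apply Cabs_ge_0.
    set (AB := (1 + p ^ 2) * (1 + q ^ 2)).
    assert (HAB : 1 <= AB) by (unfold AB; nra).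
    set (m := sqrt AB). assert (M2 : m * m = AB) by (apply sqrt_sqrt; lra).
    assert (M1 : 1 <= m) by (unfold m; rewrite <- sqrt_1; apply sqrt_le_1_alt; auto).
    assert (S : p + q <= m).
    { unfold m. rewrite <- (sqrt_square (p + q)) by lra. apply sqrt_le_1_alt. unfold AB.
      pose proof (Rle_0_sqr (1 - p * q)). unfold Rsqr in *. nra. }
    change (Rabs (/ (1 + p ^ 2) - / (1 + q ^ 2)) <= 2 * D / m).
    replace (/ (1 + p ^ 2) - / (1 + q ^ 2)) with ((q - p) * (p + q) / (m * m))
      by (rewrite M2; unfold AB; field; split; nra).
    unfold Rdiv. rewrite !Rabs_mult.
    rewrite (Rabs_pos_eq (p + q)) by lra.
    rewrite (Rabs_pos_eq (/ (m * m))) by (left; apply Rinv_0_lt_compat; nra).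
    assert (K : Rabs (q - p) <= D) by (apply Rabs_le_between; lra).
    pose proof (Rabs_pos (q - p)).
    apply (Rmult_le_reg_r (m * m)); [nra|].
    rewrite Rmult_assoc, Rinv_l by nra.
    replace (2 * D * / m * (m * m)) with (2 * D * m) by (field; lra).
    rewrite Rmult_1_r.
    apply Rle_trans with (D * m); [apply Rmult_le_compat; lra|nra].
  - rewrite Rminus_0_r. apply N.
  - rewrite Rminus_0_l, Rabs_Ropp. apply N.
  - rewrite Rminus_diag, Rabs_R0. lra.
Qed.

Lemma Efun_continuous lam z eps : 0 <= lam -> 0 < eps ->
  exists del, 0 < del /\
    forall v, Cabs (Csub v z) < del -> Cabs (Csub (Efun lam v) (Efun lam z)) < eps.
Proof.
  intros Hl He. set (C := Cabs (Efun lam z) * exp 1 + 1).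
  assert (0 <= Cabs (Efun lam z) * exp 1)
    by (apply Rmult_le_pos; [apply Cabs_ge_0|left; apply exp_pos]).
  exists (Rmin 1 (eps / C)). split.
  { apply Rmin_pos; [lra|]. apply Rdiv_lt_0_compat; unfold C; lra. }
  intros v Hv. pose proof (Rmin_l 1 (eps / C)). pose proof (Rmin_r 1 (eps / C)).
  eapply Rle_lt_trans; [apply Efun_lipschitz; auto|].
  set (d := Cabs (Csub v z)) in *. assert (0 <= d) by apply Cabs_ge_0.
  apply Rle_lt_trans with (d * (Cabs (Efun lam z) * exp 1)).
  - replace (d * (Cabs (Efun lam z) * exp 1)) with (Cabs (Efun lam z) * (d * exp 1)) by ring.
    apply Rmult_le_compat_l; [apply Cabs_ge_0|]. apply Rmult_le_compat_l; auto.
    apply exp_le_compat. lra.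
  - apply Rle_lt_trans with (d * C); [unfold C; nra|].
    assert (HC : 0 < C) by (unfold C; lra).
    replace eps with (eps / C * C) by (field; lra).
    apply Rmult_lt_compat_r; lra.
Qed.

Lemma Eiter_continuous lam n z : 0 <= lam -> forall eps, 0 < eps ->
  exists del, 0 < del /\
    forall v, Cabs (Csub v z) < del -> Cabs (Csub (Eiter lam n v) (Eiter lam n z)) < eps.
Proof.
  intros Hl. induction n as [|n IH]; intros eps He.
  - exists eps. auto.
  - destruct (Efun_continuous lam (Eiter lam n z) eps Hl He) as [d1 [H1 H2]].
    destruct (IH d1 H1) as [d2 [H3 H4]]. exists d2. split; auto.
    intros v Hv. apply H2, H4, Hv.
Qed.

(** Since lam e < 1, the half-plane of real part at most 1 is mapped into the unit disc, which lies
    in that half-plane. *)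
Lemma Eiter_bounded lam n v : 0 < lam -> lam < exp (-1) -> fst v <= 1 ->
  Cabs (Eiter lam (S n) v) <= 1.
Proof.
  intros Hl He Hv.
  assert (K : forall u, fst u <= 1 -> Cabs (Efun lam u) <= 1).
  { intros u Hu. rewrite Cabs_Efun by lra.
    apply Rle_trans with (exp (-1) * exp 1).
    - apply Rmult_le_compat; try lra; [left; apply exp_pos|apply exp_le_compat; auto].
    - rewrite <- exp_plus. replace (-1 + 1) with 0 by ring. rewrite exp_0. lra. }
  induction n as [|n IH]; [apply K; auto|].
  change (Cabs (Efun lam (Eiter lam (S n) v)) <= 1). apply K.
  pose proof (Rabs_fst_le (Eiter lam (S n) v)). pose proof (Rle_abs (fst (Eiter lam (S n) v))).
  lra.
Qed.

Lemma strictly_increasing_ge (psi : nat -> nat) :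
  (forall k, (psi k < psi (S k))%nat) -> forall k, (k <= psi k)%nat.
Proof. intros H k. induction k; [lia|]. specialize (H k). lia. Qed.

(* Points of the form "pullback of E^n z + i pi" accumulate at z and are mapped by
   E^(n+1) into the left half-plane, where orbits stay bounded, whereas the orbit of z
   escapes. *)
Lemma tracks_Julia lam T s t z : 0 < lam -> lam < exp (-1) -> doubling lam T ->
  adm lam T s t -> tracks lam s t z -> Julia lam z.
Proof.
  intros Hl He D A H [r [Hr NO]].
  destruct (NO (fun n => n)) as [psi [g [Hpsi NO2]]].
  destruct (NO2 z) as [rho [Hrho NO3]]; [rewrite Csub_diag; auto|].
  destruct (NO3 (/ 10) ltac:(lra)) as [K HK].
  destruct (Eiter_continuous lam (psi K) z ltac:(lra) 1 ltac:(lra)) as [del [Hdel C]].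
  pose proof PI_RGT_0. pose proof PI_4.
  destruct (pow_lt_1_zero (/ 2) ltac:(rewrite Rabs_pos_eq; lra) (Rmin (Rmin r rho) del / 8))
    as [n Hn].
  { apply Rdiv_lt_0_compat; [|lra]. repeat apply Rmin_pos; auto. }
  specialize (Hn n ltac:(lia)). rewrite pow_inv in Hn.
  assert (0 < / 2 ^ n) by (apply Rinv_0_lt_compat, pow_lt; lra).
  rewrite Rabs_pos_eq in Hn by lra.
  pose proof (Rmin_l (Rmin r rho) del). pose proof (Rmin_r (Rmin r rho) del).
  pose proof (Rmin_l r rho). pose proof (Rmin_r r rho).
  set (zn := Eiter lam n z).
  (* E changes sign under translation by i pi, so E^(n+1)(v) = - E^(n+1)(z). *)
  destruct (pullback lam T n Hl D s t z (fst zn, snd zn + PI) A H) as [v [Ev Hv]].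
  { fold zn. eapply Rle_trans; [apply Cabs_le_sum|]. unfold Csub; simpl.
    rewrite Rminus_diag, Rabs_R0. replace (snd zn + PI - snd zn) with PI by ring.
    rewrite Rabs_pos_eq; lra. }
  assert (Hv2 : Cabs (Csub v z) < Rmin (Rmin r rho) del) by (unfold Rdiv in *; lra).
  assert (big : 19 <= Cabs (Eiter lam (psi K) z)).
  { destruct (tracks_fst lam T s t z (psi K) D (proj1 A) H) as [F1 F2].
    pose proof (Er_ge_T lam T t (psi K) D (proj1 A)). destruct D as [D _].
    apply Rabs_le_between in F1. pose proof (Rabs_fst_le (Eiter lam (psi K) z)).
    pose proof (Rle_abs (fst (Eiter lam (psi K) z))). lra. }
  (* At index [K] the orbit of [v] is still near that of [z], hence large, which puts [g v] near
     infinity. *)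
  assert (h1 : height (g v) <= 2 / 10).
  { pose proof (C v ltac:(lra)) as C1.
    pose proof (Cabs_le_Csub (Eiter lam (psi K) z) (Eiter lam (psi K) v)) as T1.
    rewrite Csub_sym in T1.
    pose proof (HK K (Nat.le_refl K) v ltac:(lra) ltac:(lra)) as Q.
    pose proof (height_chordal (Some (Eiter lam (psi K) v)) (g v)) as Q2.
    apply Rabs_le_between in Q2.
    assert (height (Some (Eiter lam (psi K) v)) <= / 10).
    { apply Rinv_le_contravar; [lra|].
      assert (18 <= Cabs (Eiter lam (psi K) v)) by lra. nra. }
    lra. }
  (* [n + 2] leaves at least one application of E after time n + 1, as [Eiter_bounded] requires;
     then the iterate of [v] has height at least 1/2, too far from [g v]. *)
  set (k := Nat.max K (n + 2)).
  assert (small : Cabs (Eiter lam (psi k) v) <= 1).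
  { assert (E1 : fst (Eiter lam (S n) v) <= 1).
    { assert (Z1 : 0 <= fst (Efun lam zn)).
      { destruct (tracks_fst lam T s t z (S n) D (proj1 A) H) as [F1 F2].
        pose proof (Er_ge_T lam T t (S n) D (proj1 A)). destruct D as [D _].
        apply Rabs_le_between in F1. unfold zn.
        change (Efun lam (Eiter lam n z)) with (Eiter lam (S n) z). lra. }
      change (Eiter lam (S n) v) with (Efun lam (Eiter lam n v)). rewrite Ev.
      rewrite Efun_eq in *. simpl in *. rewrite neg_cos.
      pose proof (exp_pos (fst zn)). nra. }
    pose proof (strictly_increasing_ge psi Hpsi k).
    assert (ex : exists j, psi k = (S j + S n)%nat) by (exists (psi k - n - 2)%nat; lia).
    destruct ex as [j ->].
    assert (add : forall a b u, Eiter lam (a + b) u = Eiter lam a (Eiter lam b u)).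
    { intros a b u. induction a as [|a IH]; simpl; auto. rewrite IH; auto. }
    rewrite add. apply Eiter_bounded; auto. }
  pose proof (HK k ltac:(lia) v ltac:(lra) ltac:(lra)) as Q.
  pose proof (height_chordal (Some (Eiter lam (psi k) v)) (g v)) as Q2.
  apply Rabs_le_between in Q2.
  assert (/ 2 <= height (Some (Eiter lam (psi k) v))).
  { unfold height. pose proof (Cabs_ge_0 (Eiter lam (psi k) v)). apply Rinv_le_contravar; nra. }
  lra.
Qed.

Lemma in_strip_unique s s' z : in_strip s z -> in_strip s' z -> s = s'.
Proof.
  unfold in_strip. intros [A1 A2] [B1 B2]. pose proof PI_RGT_0.
  assert (IZR s < IZR s' + 1) by nra. assert (IZR s' < IZR s + 1) by nra.
  rewrite <- plus_IZR in *. apply lt_IZR in H0. apply lt_IZR in H1. lia.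
Qed.

Lemma tracks_in_strip lam T s t z n : doubling lam T -> T <= t -> tracks lam s t z ->
  in_strip (Z.of_nat (s n)) (Eiter lam n z).
Proof.
  intros D HT H. pose proof (tracks_snd lam T s t z n D HT H) as Q.
  apply Rabs_le_between in Q. pose proof PI2_3_2.
  unfold in_strip, Cim. rewrite <- INR_IZR_INZ. lra.
Qed.

Lemma Er_gap lam T n t t' : 0 < lam -> doubling lam T -> T <= t -> t <= t' ->
  t' - t <= Er lam n t' - Er lam n t.
Proof.
  intros Hl D HT Htt. induction n as [|n IH]; simpl; [lra|].
  pose proof (Er_ge_T lam T t n D HT). destruct D as [D1 D2].
  pose proof (D2 _ H). set (x := Er lam n t) in *. set (y := Er lam n t') in *.
  replace y with (x + (y - x)) by ring. rewrite exp_plus.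
  pose proof (exp_ineq1_le (y - x)). nra.
Qed.

(** The order of the two endpoints is left open: a priori, an arc parametrizing a hair need not run
    towards growing potentials. *)
Lemma IVT_between (f : R -> R) a b :
  (forall c, Rmin a b <= c <= Rmax a b -> continuity_pt f c) ->
  f a < 0 -> 0 < f b -> exists c, Rmin a b <= c <= Rmax a b /\ f c = 0.
Proof.
  intros C Ha Hb. destruct (Rtotal_order a b) as [L|[->|L]]; [| lra |].
  - rewrite Rmin_left, Rmax_right in * by lra.
    destruct (IVT_interv f a b C L Ha Hb) as [c Hc]. eauto.
  - rewrite Rmin_right, Rmax_left in * by lra.
    destruct (IVT_interv (fun x => - f x) b a) as [c [H1 H2]]; try lra.
    + intros x Hx. apply continuity_pt_opp, C, Hx.
    + exists c. split; auto. lra.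
Qed.

(* If z were the initial point of an arc parametrizing the hair, then for every n the
   arc would contain a point u_n, bounded away from z in parameter, at which Re E^n takes
   the same value as at z; but then |E^n u_n - E^n z| is bounded and u_n -> z. *)
Lemma tracks_not_endpoint lam T s t1 t t2 z : 0 < lam -> lam < exp (-1) -> doubling lam T ->
  t1 + 1 / 2 <= t -> t + 1 / 2 <= t2 ->
  adm lam T s t1 -> adm lam T s t -> adm lam T s t2 ->
  tracks lam s t z -> ~ endpoint lam z.
Proof.
  intros Hl He D Ht1 Ht2 A1 A A2 H [_ [gam [G0 [Gc [Gi [_ Gh]]]]]].
  destruct (tracks_exists lam T s t1 Hl D A1) as [z1 H1].
  destruct (tracks_exists lam T s t2 Hl D A2) as [z2 H2].
  assert (inh : forall t' z', adm lam T s t' -> tracks lam s t' z' -> hair lam z z').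
  { intros t' z' A' H'. split; [eapply tracks_Julia; eauto|].
    intros j. exists (Z.of_nat (s j)). split; eapply tracks_in_strip; eauto; [apply A|apply A']. }
  destruct (proj1 (Gh z1) (inh t1 z1 A1 H1)) as [a1 [P1 E1]].
  destruct (proj1 (Gh z2) (inh t2 z2 A2 H2)) as [a2 [P2 E2]].
  (* Real orbits that start 1/2 apart stay at least 1/2 apart, while each tracking error is at most
     1/20. *)
  assert (sep : forall n, fst (Eiter lam n z1) < fst (Eiter lam n z) < fst (Eiter lam n z2)).
  { intros n.
    destruct (tracks_fst lam T s t1 z1 n D (proj1 A1) H1) as [F1 F1'].
    destruct (tracks_fst lam T s t z n D (proj1 A) H) as [F F'].
    destruct (tracks_fst lam T s t2 z2 n D (proj1 A2) H2) as [F2 F2'].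
    pose proof (Er_gap lam T n t1 t Hl D (proj1 A1) ltac:(lra)).
    pose proof (Er_gap lam T n t t2 Hl D (proj1 A) ltac:(lra)).
    apply Rabs_le_between in F. apply Rabs_le_between in F1. apply Rabs_le_between in F2.
    lra. }
  assert (a1p : 0 < a1).
  { destruct P1; auto. subst a1. rewrite <- E1, G0 in sep. specialize (sep 0%nat). lra. }
  assert (a2p : 0 < a2).
  { destruct P2; auto. subst a2. rewrite <- E2, G0 in sep. specialize (sep 0%nat). lra. }
  assert (lop : 0 < Rmin a1 a2) by (apply Rmin_pos; auto).
  assert (comp : forall (F : Cx -> R) u, 0 < u ->
    (forall eps, 0 < eps -> exists del, 0 < del /\
      forall v, Cabs (Csub v (gam u)) < del -> Rabs (F v - F (gam u)) < eps) ->
    continuity_pt (fun u => F (gam u)) u).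
  { intros F u Hu HF eps Heps. destruct (HF eps Heps) as [d1 [Hd1 HF1]].
    destruct (Gc u ltac:(lra) d1 Hd1) as [d2 [Hd2 HF2]].
    exists (Rmin d2 u). split; [apply Rmin_pos; auto|].
    intros x [_ Hx]. simpl in *. unfold Rdist in *. apply HF1, HF2.
    - pose proof (Rmin_r d2 u). apply Rabs_def2 in Hx. lra.
    - pose proof (Rmin_l d2 u). lra. }
  (* The minimum is positive: the arc is injective and already visits [z] at parameter 0, outside
     this interval. *)
  destruct (continuity_ab_min (fun u => Cabs (Csub (gam u) z)) (Rmin a1 a2) (Rmax a1 a2))
    as [c [Hc1 Hc2]].
  { apply Rminmax. }
  { intros c Hc. apply (comp (fun v => Cabs (Csub v z))); [lra|].
    intros eps Heps. exists eps. split; auto. intros v Hv.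
    eapply Rle_lt_trans; [|apply Hv]. apply Rabs_le_between.
    pose proof (Cabs_triangle v (gam c) z). pose proof (Cabs_triangle (gam c) v z).
    rewrite (Csub_sym (gam c) v) in *. lra. }
  set (m := Cabs (Csub (gam c) z)) in *.
  assert (mp : 0 < m).
  { apply Rnot_le_lt. intros L. apply Csub_eq_0 in L. rewrite <- G0 in L.
    apply Gi in L; lra. }
  destruct (pow_lt_1_zero (/ 2) ltac:(rewrite Rabs_pos_eq; lra) (m / 8) ltac:(lra)) as [n Hn].
  specialize (Hn n ltac:(lia)). rewrite pow_inv in Hn.
  assert (0 < / 2 ^ n) by (apply Rinv_0_lt_compat, pow_lt; lra).
  rewrite Rabs_pos_eq in Hn by lra.
  destruct (IVT_between (fun u => fst (Eiter lam n (gam u)) - fst (Eiter lam n z)) a1 a2)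
    as [u [Hu1 Hu2]].
  { intros x Hx. apply (comp (fun v => fst (Eiter lam n v) - fst (Eiter lam n z))); [lra|].
    intros eps Heps.
    destruct (Eiter_continuous lam n (gam x) ltac:(lra) eps Heps) as [d [Hd HC]].
    exists d. split; auto. intros v Hv. eapply Rle_lt_trans; [|apply (HC v Hv)].
    eapply Rle_trans; [|apply Rabs_fst_sub_le]. right. f_equal. ring. }
  { rewrite E1. specialize (sep n). lra. }
  { rewrite E2. specialize (sep n). lra. }
  assert (Hu0 : 0 <= u) by lra.
  destruct (proj2 (Gh (gam u)) (ex_intro _ u (conj Hu0 eq_refl))) as [_ SI].
  assert (strips : forall j, in_strip (Z.of_nat (s j)) (Eiter lam j (gam u))).
  { intros j. destruct (SI j) as [k [K1 K2]].
    replace (Z.of_nat (s j)) with k; auto.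
    eapply in_strip_unique; [exact K1|]. eapply tracks_in_strip; eauto. apply A. }
  pose proof (same_itinerary_close lam T n Hl D s t z (gam u) A H strips) as Q.
  assert (Cabs (Csub (gam u) z) <= 8 / 2 ^ n).
  { apply Q. eapply Rle_trans; [apply Cabs_le_sum|]. unfold Csub; cbn [fst snd].
    rewrite Hu2, Rabs_R0.
    destruct (strips n) as [S1 S2].
    destruct (tracks_in_strip lam T s t z n D (proj1 A) H) as [S3 S4].
    unfold Cim in *. pose proof PI_4. rewrite Rplus_0_l. apply Rabs_le_between. lra. }
  pose proof (Hc1 u Hu1) as Q3. simpl in Q3. fold m in Q3. unfold Rdiv in *. lra.
Qed.

(** * Separation of nearby points *)

(** This is |(E^n)'(z)|, by the chain rule and E' = E. *)
Definition orbit_prod (lam : R) (z : Cx) (n : nat) : R :=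
  prod_lt (fun i => Cabs (Eiter lam (S i) z)) n.

Lemma tracks_Cabs_ge lam T s t z n : doubling lam T -> T <= t -> tracks lam s t z ->
  2 <= Cabs (Eiter lam n z).
Proof.
  intros D HT H. destruct (tracks_fst lam T s t z n D HT H) as [F1 F2].
  pose proof (Er_ge_T lam T t n D HT). destruct D as [D _].
  apply Rabs_le_between in F1. pose proof (Rabs_fst_le (Eiter lam n z)).
  pose proof (Rle_abs (fst (Eiter lam n z))). lra.
Qed.

Lemma orbit_prod_ge lam T s t z n : doubling lam T -> T <= t -> tracks lam s t z ->
  2 ^ n <= orbit_prod lam z n.
Proof.
  intros D HT H. unfold orbit_prod. induction n as [|n IH]; [simpl; lra|].
  assert (0 < 2 ^ n) by (apply pow_lt; lra).
  pose proof (tracks_Cabs_ge lam T s t z (S n) D HT H) as Q.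
  change (2 * 2 ^ n <= prod_lt (fun i => Cabs (Eiter lam (S i) z)) n * Cabs (Eiter lam (S n) z)).
  nra.
Qed.

Lemma orbit_prod_S_ge lam T s t z n : doubling lam T -> T <= t -> tracks lam s t z ->
  2 * orbit_prod lam z n <= orbit_prod lam z (S n).
Proof.
  intros D HT H. pose proof (orbit_prod_ge lam T s t z n D HT H).
  assert (0 < 2 ^ n) by (apply pow_lt; lra).
  pose proof (tracks_Cabs_ge lam T s t z (S n) D HT H) as Q.
  change (orbit_prod lam z (S n)) with (orbit_prod lam z n * Cabs (Eiter lam (S n) z)).
  nra.
Qed.

Lemma exp_le_3_of_le_1 x : x <= 1 -> exp x <= 3.
Proof. intros H. eapply Rle_trans; [apply exp_le_compat, H|apply exp_le_3]. Qed.

(** The exponent is chosen so that the induction closes: one step adds another 3 d P to it, where P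
    is the current product, and P at least doubles in that step. *)
Lemma orbits_close lam T s t z v d n : 0 < lam -> doubling lam T -> T <= t ->
  tracks lam s t z -> 0 < d -> Cabs (Csub v z) <= d ->
  3 * (d * orbit_prod lam z n) <= 1 ->
  Cabs (Csub (Eiter lam n v) (Eiter lam n z))
    <= d * orbit_prod lam z n * exp (3 * (d * orbit_prod lam z n)).
Proof.
  intros Hl D HT H Hd Hv. induction n as [|n IH]; intros Hn.
  - unfold orbit_prod in *. simpl. pose proof (exp_ineq1_le (3 * (d * 1))). nra.
  - pose proof (orbit_prod_S_ge lam T s t z n D HT H) as G2.
    pose proof (orbit_prod_ge lam T s t z n D HT H) as G1.
    assert (0 < 2 ^ n) by (apply pow_lt; lra).
    specialize (IH ltac:(nra)).
    pose proof (Efun_lipschitz lam (Eiter lam n v) (Eiter lam n z) ltac:(lra)) as L.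
    change (Efun lam (Eiter lam n z)) with (Eiter lam (S n) z) in L.
    change (Efun lam (Eiter lam n v)) with (Eiter lam (S n) v) in L.
    eapply Rle_trans; [apply L|].
    assert (E : orbit_prod lam z (S n) = orbit_prod lam z n * Cabs (Eiter lam (S n) z))
      by reflexivity.
    set (P := orbit_prod lam z n) in *. set (P' := orbit_prod lam z (S n)) in *.
    set (c := Cabs (Eiter lam (S n) z)) in *.
    set (del := Cabs (Csub (Eiter lam n v) (Eiter lam n z))) in *.
    assert (0 <= del) by apply Cabs_ge_0. assert (0 <= c) by apply Cabs_ge_0.
    assert (G0 : 0 < d * P) by (apply Rmult_lt_0_compat; lra).
    assert (E3 : exp (3 * (d * P)) <= 3) by (apply exp_le_3_of_le_1; nra).
    assert (del <= 3 * (d * P)) by nra.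
    assert (exp del <= exp (3 * (d * P))) by (apply exp_le_compat; auto).
    apply Rle_trans with (c * ((d * P * exp (3 * (d * P))) * exp (3 * (d * P)))).
    + apply Rmult_le_compat_l; auto. apply Rmult_le_compat; auto. left; apply exp_pos.
    + rewrite Rmult_assoc, <- exp_plus.
      replace (c * (d * P * exp (3 * (d * P) + 3 * (d * P))))
        with (d * P' * exp (3 * (d * P) + 3 * (d * P))) by (rewrite E; ring).
      apply Rmult_le_compat_l; [nra|]. apply exp_le_compat. nra.
Qed.

Lemma orbits_close_3 lam T s t z v d n : 0 < lam -> doubling lam T -> T <= t ->
  tracks lam s t z -> 0 < d -> Cabs (Csub v z) <= d ->
  3 * (d * orbit_prod lam z n) <= 1 ->
  Cabs (Csub (Eiter lam n v) (Eiter lam n z)) <= 3 * (d * orbit_prod lam z n).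
Proof.
  intros Hl D HT H Hd Hv Hn.
  eapply Rle_trans; [eapply orbits_close; eauto|].
  pose proof (orbit_prod_ge lam T s t z n D HT H) as G1.
  assert (0 < 2 ^ n) by (apply pow_lt; lra).
  pose proof (exp_le_3_of_le_1 _ Hn).
  assert (0 < d * orbit_prod lam z n) by (apply Rmult_lt_0_compat; lra). nra.
Qed.

(** One step past the range of [orbits_close] the bound is still linear, though no longer small;
    potentials are compared at this time. *)
Lemma orbits_close_next lam T s t z v d n : 0 < lam -> doubling lam T -> T <= t ->
  tracks lam s t z -> 0 < d -> Cabs (Csub v z) <= d ->
  3 * (d * orbit_prod lam z n) <= 1 ->
  Cabs (Csub (Eiter lam (S n) v) (Eiter lam (S n) z)) <= 9 * (d * orbit_prod lam z (S n)).
Proof.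
  intros Hl D HT H Hd Hv Hn.
  pose proof (orbits_close_3 lam T s t z v d n Hl D HT H Hd Hv Hn) as C.
  pose proof (Efun_lipschitz lam (Eiter lam n v) (Eiter lam n z) ltac:(lra)) as L.
  change (Efun lam (Eiter lam n z)) with (Eiter lam (S n) z) in L.
  change (Efun lam (Eiter lam n v)) with (Eiter lam (S n) v) in L.
  eapply Rle_trans; [apply L|].
  change (orbit_prod lam z (S n)) with (orbit_prod lam z n * Cabs (Eiter lam (S n) z)).
  set (P := orbit_prod lam z n) in *. set (c := Cabs (Eiter lam (S n) z)) in *.
  set (del := Cabs (Csub (Eiter lam n v) (Eiter lam n z))) in *.
  assert (0 <= del) by apply Cabs_ge_0. assert (0 <= c) by apply Cabs_ge_0.
  assert (exp del <= 3) by (apply exp_le_3_of_le_1; lra).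
  replace (9 * (d * (P * c))) with (c * (3 * (d * P) * 3)) by ring.
  apply Rmult_le_compat_l; auto. apply Rmult_le_compat; auto. left; apply exp_pos.
Qed.

Lemma tracks_digit_eq lam T s t z s' t' z' n : doubling lam T -> T <= t -> T <= t' ->
  tracks lam s t z -> tracks lam s' t' z' ->
  Cabs (Csub (Eiter lam n z') (Eiter lam n z)) <= 1 -> s n = s' n.
Proof.
  intros D HT HT' H H' C.
  pose proof (tracks_snd lam T s t z n D HT H) as Q.
  pose proof (tracks_snd lam T s' t' z' n D HT' H') as Q'.
  pose proof (Rabs_snd_sub_le (Eiter lam n z') (Eiter lam n z)) as Q2.
  assert (Q3 : Rabs (snd (Eiter lam n z') - snd (Eiter lam n z)) <= 1) by lra. clear Q2.
  apply Rabs_le_between in Q. apply Rabs_le_between in Q'. apply Rabs_le_between in Q3.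
  pose proof PI2_3_2.
  assert (INR (s n) < INR (s' n + 1)) by (rewrite plus_INR; simpl; nra).
  assert (INR (s' n) < INR (s n + 1)) by (rewrite plus_INR; simpl; nra).
  apply INR_lt in H1. apply INR_lt in H2. lia.
Qed.

(** The tracking errors 1/E^i(t) are at most 1/(20 2^i), and for i < n these bounds sum in the
    exponent to (2 - 2/2^n)/20. *)
Lemma orbit_prod_le lam T s t z n : 0 < lam -> doubling lam T -> T <= t -> tracks lam s t z ->
  orbit_prod lam z n
    <= prod_lt (fun i => Er lam (S i) t) n * exp ((2 - 2 / 2 ^ n) / 20).
Proof.
  intros Hl D HT H. induction n as [|n IH].
  - unfold orbit_prod; simpl. replace ((2 - 2 / 1) / 20) with 0 by field. rewrite exp_0. lra.
  - change (orbit_prod lam z (S n)) with (orbit_prod lam z n * Cabs (Efun lam (Eiter lam n z))).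
    change (prod_lt (fun i => Er lam (S i) t) (S n))
      with (prod_lt (fun i => Er lam (S i) t) n * (lam * exp (Er lam n t))).
    rewrite Cabs_Efun by lra.
    destruct (tracks_fst lam T s t z n D HT H) as [F _]. apply Rabs_le_between in F.
    pose proof (Er_ge lam T t n D HT) as G.
    assert (P2 : 0 < 2 ^ n) by (apply pow_lt; lra). pose proof (proj1 D) as D1.
    assert (I : / Er lam n t <= / (2 ^ n * 20)).
    { apply Rinv_le_contravar; [lra|]. nra. }
    assert (E : exp (fst (Eiter lam n z)) <= exp (Er lam n t) * exp (/ (2 ^ n * 20))).
    { rewrite <- exp_plus. apply exp_le_compat. lra. }
    set (A := prod_lt (fun i => Er lam (S i) t) n) in *.
    replace ((2 - 2 / 2 ^ S n) / 20) with ((2 - 2 / 2 ^ n) / 20 + / (2 ^ n * 20))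
      by (simpl; field; lra).
    rewrite exp_plus.
    pose proof (orbit_prod_ge lam T s t z n D HT H). pose proof (exp_pos (fst (Eiter lam n z))).
    eapply Rle_trans; [apply Rmult_le_compat|];
      [lra|nra|exact IH|apply Rmult_le_compat_l; [lra|exact E]|].
    right. ring.
Qed.

(** The product is the derivative at [t] of the convex function E^n. *)
Lemma Er_expand lam T n t t' : 0 < lam -> doubling lam T -> T <= t -> t <= t' ->
  prod_lt (fun i => Er lam (S i) t) n * (t' - t) <= Er lam n t' - Er lam n t.
Proof.
  intros Hl D HT Htt. induction n as [|n IH]; [simpl; lra|].
  pose proof (Er_ge_T lam T t (S n) D HT) as G.
  change (prod_lt (fun i => Er lam (S i) t) (S n))
    with (prod_lt (fun i => Er lam (S i) t) n * Er lam (S n) t).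
  change (Er lam (S n) t') with (lam * exp (Er lam n t')).
  change (Er lam (S n) t) with (lam * exp (Er lam n t)) in *.
  set (x := Er lam n t) in *. set (y := Er lam n t') in *.
  replace y with (x + (y - x)) at 1 by ring. rewrite exp_plus.
  pose proof (exp_ineq1_le (y - x)). destruct D as [D _].
  set (e := lam * exp x) in *.
  replace (lam * (exp x * exp (y - x)) - e) with (e * (exp (y - x) - 1)) by (unfold e; ring).
  replace (prod_lt (fun i => Er lam (S i) t) n * e * (t' - t))
    with (e * (prod_lt (fun i => Er lam (S i) t) n * (t' - t))) by ring.
  apply Rmult_le_compat_l; lra.
Qed.

Lemma crossing_index lam T s t z d : doubling lam T -> T <= t -> tracks lam s t z ->
  0 < d < / 3 ->
  exists j, 3 * (d * orbit_prod lam z j) <= 1 /\ 1 < 3 * (d * orbit_prod lam z (S j)).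
Proof.
  intros D HT H Hd.
  destruct (Pow_x_infinity 2 ltac:(rewrite Rabs_pos_eq; lra) (/ d)) as [n Hn].
  specialize (Hn n ltac:(lia)). rewrite Rabs_pos_eq in Hn by (left; apply pow_lt; lra).
  assert (big : 1 < 3 * (d * orbit_prod lam z n)).
  { pose proof (orbit_prod_ge lam T s t z n D HT H).
    assert (1 <= d * orbit_prod lam z n).
    { replace 1 with (d * / d) by (field; lra). apply Rmult_le_compat_l; lra. }
    lra. }
  clear Hn. induction n as [|n IH].
  - unfold orbit_prod in big. simpl in big. lra.
  - destruct (Rle_dec (3 * (d * orbit_prod lam z n)) 1) as [L|L]; [eauto|].
    apply IH. lra.
Qed.

(** Compare real parts just past the crossing index. The orbits differ there by at most 9 d P,
    tracking adds at most 1/10 < 3 d P / 10, and the real orbits are at least A (t' - t) apart, A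
    being the real derivative, with P <= 3 A. This gives 27.9 d, rounded up to 30 d. *)
Lemma potential_close lam T s t z s' t' z' d : 0 < lam -> doubling lam T ->
  T <= t -> t <= t' -> tracks lam s t z -> tracks lam s' t' z' ->
  0 < d < / 3 -> Cabs (Csub z' z) <= d -> t' - t <= 30 * d.
Proof.
  intros Hl D HT Htt H H' Hd C.
  destruct (crossing_index lam T s t z d D HT H Hd) as [j [J1 J2]].
  pose proof (orbits_close_next lam T s t z z' d j Hl D HT H ltac:(lra) C J1) as Q.
  destruct (tracks_fst lam T s t z (S j) D HT H) as [F1 F2].
  destruct (tracks_fst lam T s' t' z' (S j) D ltac:(lra) H') as [F3 F4].
  pose proof (Rabs_fst_sub_le (Eiter lam (S j) z') (Eiter lam (S j) z)) as Q2.
  assert (Q3 : Rabs (fst (Eiter lam (S j) z') - fst (Eiter lam (S j) z))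
               <= 9 * (d * orbit_prod lam z (S j))) by lra.
  apply Rabs_le_between in F1. apply Rabs_le_between in F3. apply Rabs_le_between in Q3.
  pose proof (Er_expand lam T (S j) t t' Hl D HT Htt) as X.
  pose proof (orbit_prod_le lam T s t z (S j) Hl D HT H) as Y.
  set (A := prod_lt (fun i => Er lam (S i) t) (S j)) in *.
  assert (E : exp ((2 - 2 / 2 ^ S j) / 20) <= 3).
  { apply exp_le_3_of_le_1. assert (0 < / 2 ^ S j) by (apply Rinv_0_lt_compat, pow_lt; lra).
    unfold Rdiv. lra. }
  assert (A0 : 0 < A).
  { apply prod_lt_pos. intros i. pose proof (Er_ge_T lam T t (S i) D HT).
    destruct D as [D _]. lra. }
  set (P := orbit_prod lam z (S j)) in *.
  assert (P <= A * 3) by (eapply Rle_trans; [exact Y|]; apply Rmult_le_compat_l; lra).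
  assert (d * P <= d * (A * 3)) by (apply Rmult_le_compat_l; lra).
  assert (A * (t' - t) <= A * (30 * d)) by nra.
  apply (Rmult_le_reg_l A); auto.
Qed.

Lemma Er_double lam T n b : 0 < lam -> doubling lam T -> T <= b ->
  2 * Er lam n b <= Er lam n (2 * b).
Proof.
  intros Hl D HT. induction n as [|n IH]; [simpl; lra|].
  pose proof (Er_ge_T lam T b n D HT). destruct D as [D _].
  change (2 * (lam * exp (Er lam n b)) <= lam * exp (Er lam n (2 * b))).
  set (y := Er lam n b) in *.
  assert (exp (y + y) <= exp (Er lam n (2 * b))) by (apply exp_le_compat; lra).
  rewrite exp_plus in H0. pose proof (exp_ineq1_le y). pose proof (exp_pos y).
  assert (2 * exp y <= exp y * exp y) by nra. nra.
Qed.

(** The margin in t + 1 absorbs the tracking error, and the doubling splits exp Y into two factors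
    exp (Y / 2): one bounds the previous product, the other the new derivative. *)
Lemma orbit_prod_le_Er lam T s t z n : 0 < lam -> doubling lam T -> T <= t ->
  tracks lam s t z -> 3 * orbit_prod lam z n <= Er lam n (2 * (t + 1)).
Proof.
  intros Hl D HT H. assert (D1 := proj1 D). induction n as [|n IH].
  - unfold orbit_prod; simpl. lra.
  - change (orbit_prod lam z (S n)) with (orbit_prod lam z n * Cabs (Efun lam (Eiter lam n z))).
    rewrite Cabs_Efun by lra.
    change (Er lam (S n) (2 * (t + 1))) with (lam * exp (Er lam n (2 * (t + 1)))).
    destruct (tracks_fst lam T s t z n D HT H) as [F1 F2]. apply Rabs_le_between in F1.
    pose proof (Er_gap lam T n t (t + 1) Hl D HT ltac:(lra)).
    pose proof (Er_double lam T n (t + 1) Hl D ltac:(lra)).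
    pose proof (Er_ge_T lam T (t + 1) n D ltac:(lra)).
    set (Y := Er lam n (2 * (t + 1))) in *. set (y := Er lam n (t + 1)) in *.
    assert (exp (fst (Eiter lam n z)) <= exp (Y / 2)) by (apply exp_le_compat; lra).
    assert (Y <= exp (Y / 2)).
    { pose proof (exp_ineq1_le (Y / 4)).
      replace (Y / 2) with (Y / 4 + Y / 4) by field. rewrite exp_plus.
      pose proof (Rle_0_sqr (1 - Y / 4)). unfold Rsqr in *. nra. }
    replace (exp Y) with (exp (Y / 2) * exp (Y / 2)) by (rewrite <- exp_plus; f_equal; field).
    pose proof (orbit_prod_ge lam T s t z n D HT H).
    assert (0 < 2 ^ n) by (apply pow_lt; lra).
    pose proof (exp_pos (fst (Eiter lam n z))).
    apply Rle_trans with (lam * ((3 * orbit_prod lam z n) * exp (fst (Eiter lam n z))));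
      [right; ring|].
    apply Rmult_le_compat_l; [lra|]. apply Rmult_le_compat; lra.
Qed.

Lemma separation lam T s t z d : 0 < lam -> doubling lam T ->
  T <= t -> tracks lam s t z -> 0 < d < / 3 ->
  exists j, / d < Er lam (S j) (2 * (t + 1)) /\
    forall s' t' z', T <= t' -> tracks lam s' t' z' -> Cabs (Csub z' z) <= d ->
      (forall i, (i <= j)%nat -> s i = s' i) /\ Rabs (t' - t) <= 30 * d.
Proof.
  intros Hl D HT H Hd.
  destruct (crossing_index lam T s t z d D HT H Hd) as [j [J1 J2]].
  exists j. split.
  - pose proof (orbit_prod_le_Er lam T s t z (S j) Hl D HT H).
    apply (Rmult_lt_reg_l d); [lra|]. rewrite Rinv_r by lra.
    apply Rlt_le_trans with (d * (3 * orbit_prod lam z (S j))); [lra|].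
    apply Rmult_le_compat_l; lra.
  - intros s' t' z' HT' H' C. split.
    + assert (mono : forall k i, 3 * (d * orbit_prod lam z (i + k)) <= 1 ->
                       3 * (d * orbit_prod lam z i) <= 1).
      { induction k as [|k IH]; intros i Hi; [rewrite Nat.add_0_r in Hi; auto|].
        apply IH. rewrite Nat.add_succ_r in Hi.
        pose proof (orbit_prod_S_ge lam T s t z (i + k) D HT H).
        pose proof (orbit_prod_ge lam T s t z (i + k) D HT H).
        assert (0 < 2 ^ (i + k)) by (apply pow_lt; lra). nra. }
      intros i Hi. assert (Gi : 3 * (d * orbit_prod lam z i) <= 1).
      { apply (mono (j - i)%nat). replace (i + (j - i))%nat with j by lia. auto. }
      eapply (tracks_digit_eq lam T s t z s' t' z'); eauto.
      pose proof (orbits_close_3 lam T s t z z' d i Hl D HT H ltac:(lra) C Gi). lra.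
    + destruct (Rle_dec t t') as [L|L].
      * rewrite Rabs_pos_eq by lra. eapply (potential_close lam T s t z s' t' z'); eauto.
      * rewrite Rabs_left by lra. rewrite Csub_sym in C.
        pose proof (potential_close lam T s' t' z' s t z d Hl D HT' ltac:(lra) H' H Hd C). lra.
Qed.

Lemma Er_monotone_index lam T x n m : doubling lam T -> T <= x -> (n <= m)%nat ->
  Er lam n x <= Er lam m x.
Proof.
  intros D HT H. induction H as [|m H IH]; [lra|].
  pose proof (Er_ge_T lam T x m D HT). destruct D as [D1 D2]. pose proof (D2 _ H0).
  simpl. lra.
Qed.

(** With X = E^n(t) and t >= 2 A, the digit at time n + 1 is at most lam exp(X/2), on the
    square-root scale of E^(n+1)(t) = lam exp X. The terms 256 and 16/lam of the threshold yield 16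
    X <= exp(X/2) and 4 X <= lam exp X. *)
Lemma shadowing_threshold lam : 0 < lam -> exists T, doubling lam T /\
  forall A s t, T <= A -> 2 * A <= t -> (forall n, INR (s n) <= Er lam n A) -> adm lam T s t.
Proof.
  intros Hl. destruct (doubling_exists lam Hl) as [T0 [D1 D2]].
  assert (Hi : 0 < 16 / lam) by (apply Rdiv_lt_0_compat; lra).
  exists (T0 + 256 + 16 / lam).
  assert (D : doubling lam (T0 + 256 + 16 / lam)).
  { split; [lra|]. intros; apply D2; lra. }
  split; auto. intros A s t HA Ht Hs. split; [lra|]. intros n.
  specialize (Hs (S n)).
  pose proof (Er_ge_T lam _ t n D ltac:(lra)) as HX.
  pose proof (Er_double lam _ n A Hl D ltac:(lra)) as H2.
  pose proof (Er_monotone lam n (2 * A) t ltac:(lra) Ht) as H3.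
  simpl Er in *. set (X := Er lam n t) in *. set (Y := Er lam n A) in *.
  assert (E : exp Y <= exp (X / 2)) by (apply exp_le_compat; lra).
  assert (E2 : exp X = exp (X / 2) * exp (X / 2)) by (rewrite <- exp_plus; f_equal; field).
  pose proof (exp_ge_sqr (X / 2) ltac:(lra)) as Q1.
  pose proof (exp_ge_sqr X ltac:(lra)) as Q2.
  pose proof PI_4. pose proof PI_RGT_0.
  assert (Q3 : 16 * X <= exp (X / 2)) by nra.
  assert (Q4 : 2 * X <= lam * exp X / 2).
  { apply Rle_trans with (lam * (X * X / 4) / 2).
    - assert (16 <= lam * X).
      { replace 16 with (lam * (16 / lam)) by (field; lra). apply Rmult_le_compat_l; lra. }
      nra.
    - apply Rmult_le_compat_r; [lra|]. apply Rmult_le_compat_l; lra. }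
  pose proof (exp_pos (X / 2)).
  assert (Q5 : INR (s (S n)) <= lam * exp (X / 2)).
  { eapply Rle_trans; [exact Hs|]. apply Rmult_le_compat_l; lra. }
  pose proof (pos_INR (s (S n))).
  assert (Q6 : 2 * PI * INR (s (S n)) <= 8 * (lam * exp (X / 2))) by nra.
  assert (Q7 : 8 * (lam * exp (X / 2)) * X <= lam * exp X / 2).
  { rewrite E2. replace (8 * (lam * exp (X / 2)) * X)
      with ((lam * exp (X / 2)) * (16 * X) / 2) by field.
    replace (lam * (exp (X / 2) * exp (X / 2)) / 2)
      with ((lam * exp (X / 2)) * exp (X / 2) / 2) by field.
    apply Rmult_le_compat_r; [lra|]. apply Rmult_le_compat_l; nra. }
  assert (2 * PI * INR (s (S n)) * X <= 8 * (lam * exp (X / 2)) * X)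
    by (apply Rmult_le_compat_r; lra).
  lra.
Qed.

(** * Digit ranges, diameters and box masses *)

Definition digits (lam A : R) (n : nat) : nat := Z.to_nat (up (Er lam n A)).

Lemma digits_spec lam A n : 0 < Er lam n A ->
  (0 < digits lam A n)%nat /\ Er lam n A <= INR (digits lam A n) /\
  forall k, (k < digits lam A n)%nat -> INR k <= Er lam n A.
Proof.
  intros H. unfold digits. destruct (archimed (Er lam n A)) as [U1 U2].
  set (z := up (Er lam n A)) in *.
  assert (Z1 : (0 < z)%Z) by (apply lt_IZR; lra).
  assert (E : INR (Z.to_nat z) = IZR z) by (rewrite INR_IZR_INZ, Z2Nat.id by lia; auto).
  split; [lia|]. split; [lra|]. intros k Hk.
  assert (INR k + 1 <= INR (Z.to_nat z)) by (rewrite <- S_INR; apply le_INR; lia). lra.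
Qed.

Lemma is_diam_ge A d z w : is_diam A d -> A z -> A w -> Cabs (Csub z w) <= d.
Proof.
  intros [[E _]|[ub _]] Hz Hw; [exfalso; eapply E; eauto|]. apply ub. eauto.
Qed.

Lemma is_diam_nonneg A d : is_diam A d -> 0 <= d.
Proof.
  intros H. destruct (excluded_middle_informative (exists z, A z)) as [[z Hz]|N].
  - pose proof (is_diam_ge A d z z H Hz Hz) as Q. rewrite Csub_diag in Q. auto.
  - destruct H as [[_ ->]|[_ lub]]; [lra|].
    specialize (lub (d - 1)). assert (d <= d - 1); [|lra].
    apply lub. intros r [z [w [Hz _]]]. exfalso; eauto.
Qed.

Lemma sum_half_pow K : sum_f_R0 (fun k => (/ 2) ^ k) K = 2 - (/ 2) ^ K.
Proof. induction K; simpl; [field|]. rewrite IHK. field. Qed.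

Lemma div_prod_lt_le N j d e : (forall i, (0 < N i)%nat) -> 0 < e -> e <= INR (N j) -> 0 <= d ->
  d / prod_lt (fun i => INR (N i)) (S j) <= d / e.
Proof.
  intros HN He HNj Hd. unfold Rdiv. apply Rmult_le_compat_l; auto.
  apply Rinv_le_contravar; auto. simpl.
  assert (P : forall m, 1 <= prod_lt (fun i => INR (N i)) m).
  { induction m as [|m IH]; simpl; [lra|].
    assert (1 <= INR (N m)) by (apply (le_INR 1), HN). nra. }
  specialize (P j). nra.
Qed.

(** * The Schroder function on the positive axis *)

Lemma has_cderiv_continuous f z d eps : has_cderiv f z d -> 0 < eps ->
  exists del, 0 < del /\ forall h, Cabs h < del -> Cabs (Csub (f (Cadd z h)) (f z)) < eps.
Proof.
  intros H He. destruct (H 1 ltac:(lra)) as [d1 [H1 H2]].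
  set (C := 2 + Cabs d). assert (0 <= Cabs d) by apply Cabs_ge_0.
  exists (Rmin d1 (eps / C)). split.
  { apply Rmin_pos; auto. apply Rdiv_lt_0_compat; unfold C; lra. }
  intros h Hh. pose proof (Rmin_l d1 (eps / C)). pose proof (Rmin_r d1 (eps / C)).
  specialize (H2 h ltac:(lra)).
  pose proof (Cabs_le_Csub (Csub (f (Cadd z h)) (f z)) (Cmul d h)) as T.
  assert (M : Cabs (Cmul d h) = Cabs d * Cabs h).
  { rewrite !Cabs_Cmod. apply Cmod_mult. }
  pose proof (Cabs_ge_0 h).
  apply Rle_lt_trans with (Cabs h * C); [unfold C; nra|].
  assert (HC : 0 < C) by (unfold C; lra).
  replace eps with (eps / C * C) by (field; lra). apply Rmult_lt_compat_r; lra.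
Qed.

Section Schroder.

Context (lam beta : R) (Sf : Cx -> Cx).
Context (Hl : 0 < lam) (Hb : 1 < beta).
Context (Hent : entire Sf).
Context (Heq : forall z, Sf (Cmul (Cof beta) z) = Efun lam (Sf z)).
Context (H0 : Sf (Cof 0) = Cof beta).
Context (Hd : has_cderiv Sf (Cof 0) (Cof 1)).
Context (Hfix : lam * exp beta = beta).

Let sg (u : R) : R := Cre (Sf (Cof u)).
Let im (u : R) : R := Cim (Sf (Cof u)).

Lemma schroder_real_eq u : Sf (Cof (beta * u)) = Efun lam (Sf (Cof u)).
Proof.
  rewrite <- Heq. f_equal. unfold Cmul, Cof; simpl. f_equal; ring.
Qed.

Lemma schroder_near_0 eps : 0 < eps -> exists del, 0 < del /\ forall u, Rabs u < del ->
  Rabs (sg u - beta - u) <= eps * Rabs u /\ Rabs (im u) <= eps * Rabs u.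
Proof.
  intros He. destruct (Hd eps He) as [del [H1 H2]]. exists del. split; auto.
  intros u Hu.
  assert (A : Cabs (Cof u) = Rabs u).
  { unfold Cabs, Cof; simpl. rewrite <- sqrt_Rsqr_abs. f_equal. unfold Rsqr. ring. }
  specialize (H2 (Cof u)). rewrite A in H2. specialize (H2 Hu).
  rewrite H0 in H2. replace (Cadd (Cof 0) (Cof u)) with (Cof u) in H2
    by (unfold Cadd, Cof; simpl; f_equal; ring).
  pose proof (Rabs_fst_le (Csub (Csub (Sf (Cof u)) (Cof beta)) (Cmul (Cof 1) (Cof u)))) as F.
  pose proof (Rabs_snd_le (Csub (Csub (Sf (Cof u)) (Cof beta)) (Cmul (Cof 1) (Cof u)))) as G.
  unfold Csub, Cmul, Cof in F, G; simpl in F, G.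
  unfold sg, im, Cre, Cim. split.
  - eapply Rle_trans; [|exact H2]. eapply Rle_trans; [|exact F]. right. unfold Cof. f_equal. ring.
  - eapply Rle_trans; [|exact H2]. eapply Rle_trans; [|exact G]. right. unfold Cof. f_equal. ring.
Qed.

Lemma descend_scale (u del : R) : 0 < u -> 0 < del ->
  exists n, 0 < u / beta ^ n < del.
Proof.
  intros Hu Hdel.
  destruct (pow_lt_1_zero (/ beta)) with (y := del / u) as [n Hn].
  - rewrite Rabs_pos_eq by (left; apply Rinv_0_lt_compat; lra).
    rewrite <- Rinv_1. apply Rinv_lt_contravar; lra.
  - apply Rdiv_lt_0_compat; auto.
  - exists n. specialize (Hn n ltac:(lia)). rewrite pow_inv in Hn.
    assert (0 < / beta ^ n) by (apply Rinv_0_lt_compat, pow_lt; lra).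
    rewrite Rabs_pos_eq in Hn by lra. unfold Rdiv in *. split; [nra|].
    apply (Rmult_lt_compat_l u) in Hn; auto.
    replace (u * (del * / u)) with del in Hn by (field; lra). lra.
Qed.

(** Division by a power of [beta] brings any positive [u] close to 0; the step hypothesis carries
    [P] back up. *)
Lemma schroder_induction (P : R -> Prop) (del : R) : 0 < del ->
  (forall u, 0 < u < del -> P u) -> (forall u, 0 < u -> P u -> P (beta * u)) ->
  forall u, 0 < u -> P u.
Proof.
  intros Hdel Hs Hi u Hu. destruct (descend_scale u del Hu Hdel) as [n Hn].
  assert (K : forall m, P (beta ^ m * (u / beta ^ n))).
  { induction m as [|m IH]; [simpl; rewrite Rmult_1_l; auto|].
    simpl. rewrite Rmult_assoc. apply Hi; auto.
    apply Rmult_lt_0_compat; [apply pow_lt; lra|lra]. }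
  specialize (K n). replace (beta ^ n * (u / beta ^ n)) with u in K; auto.
  field. apply pow_nonzero. lra.
Qed.

(* |Im S(v)| exp(-K v) / v does not increase when v is multiplied by beta (for small v),
   and it tends to 0 as v -> 0. *)
Lemma schroder_im_0 u : 0 < u -> im u = 0.
Proof.
  destruct (schroder_near_0 1 ltac:(lra)) as [d1 [Hd1 N1]].
  revert u. apply (schroder_induction _ d1 Hd1).
  2:{ intros u Hu Hi. unfold im in *. rewrite schroder_real_eq, Efun_eq.
      unfold Cim in *; simpl. rewrite Hi, sin_0. ring. }
  intros v Hv.
  (* Near 0, Re S(w) <= beta + 2 w bounds the expansion of E by beta exp(2 w). As K (beta - 1) = 2,
     the weight absorbs exactly the factor exp(2 w). *)
  set (K := 2 / (beta - 1)).
  assert (HK : 0 < K) by (apply Rdiv_lt_0_compat; lra).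
  set (F := fun w => Rabs (im w) * exp (- K * w) / w).
  assert (Fstep : forall w, 0 < w < d1 -> F (beta * w) <= F w).
  { intros w Hw. unfold F, im. rewrite schroder_real_eq, Efun_eq. unfold Cim; cbn [snd].
    destruct (N1 w) as [N _]; [rewrite Rabs_pos_eq; lra|].
    rewrite (Rabs_pos_eq w) in N by lra. apply Rabs_le_between in N.
    unfold sg, Cre in N.
    set (x := fst (Sf (Cof w))) in *. set (y := snd (Sf (Cof w))).
    assert (S1 : Rabs (sin y) <= Rabs y).
    { destruct (Req_dec y 0) as [->|Hy]; [rewrite sin_0; lra|].
      destruct (Rle_dec 0 y).
      - rewrite (Rabs_pos_eq y) by lra. apply Rabs_le_between.
        pose proof (sin_lt_x y ltac:(lra)).
        split; [|lra]. destruct (Rle_dec y 1).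
        + pose proof (sin_ge_0 y ltac:(lra)). pose proof PI2_3_2. lra.
        + pose proof (SIN_bound y). lra.
      - rewrite (Rabs_left y) by lra. apply Rabs_le_between.
        pose proof (sin_lt_x (- y) ltac:(lra)) as Q. rewrite sin_neg in Q.
        split; [lra|]. destruct (Rle_dec (- y) 1).
        + pose proof PI2_3_2. pose proof (sin_ge_0 (- y) ltac:(lra) ltac:(lra)) as Q2.
          rewrite sin_neg in Q2. lra.
        + pose proof (SIN_bound y). lra. }
    rewrite !Rabs_mult, (Rabs_pos_eq lam), (Rabs_pos_eq (exp x)) by
      (try (left; apply exp_pos); lra).
    assert (E : lam * exp x <= beta * exp (2 * w)).
    { rewrite <- Hfix at 1. rewrite Rmult_assoc, <- exp_plus.
      apply Rmult_le_compat_l; [lra|]. apply exp_le_compat. lra. }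
    pose proof (Rabs_pos y). pose proof (Rabs_pos (sin y)). pose proof (exp_pos x).
    pose proof (exp_pos (- K * (beta * w))).
    apply Rle_trans with ((beta * exp (2 * w)) * Rabs y * exp (- K * (beta * w)) / (beta * w)).
    - unfold Rdiv. apply Rmult_le_compat_r; [left; apply Rinv_0_lt_compat; nra|].
      apply Rmult_le_compat_r; [lra|]. rewrite <- Rmult_assoc.
      apply Rmult_le_compat; auto. nra.
    - right. replace (- K * w) with (2 * w + - K * (beta * w)).
      + rewrite exp_plus. field. lra.
      + unfold K. field. lra. }
  assert (F0 : forall w, 0 < w -> 0 <= F w).
  { intros w Hw. unfold F, Rdiv. apply Rmult_le_pos; [|left; apply Rinv_0_lt_compat; auto].
    apply Rmult_le_pos; [apply Rabs_pos|left; apply exp_pos]. }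
  assert (Fiter : forall n, F v <= F (v / beta ^ n)).
  { induction n as [|n IH]; [simpl; right; f_equal; field|].
    eapply Rle_trans; [exact IH|].
    assert (P1 : 0 < beta ^ n) by (apply pow_lt; lra).
    assert (P2 : 1 <= beta ^ S n) by (apply pow_R1_Rle; lra).
    replace (v / beta ^ n) with (beta * (v / beta ^ S n)) by (simpl; field; lra).
    apply Fstep. split; [apply Rdiv_lt_0_compat; lra|].
    apply Rle_lt_trans with v; [|lra]. apply (Rmult_le_reg_r (beta ^ S n)); [lra|].
    unfold Rdiv. rewrite Rmult_assoc, Rinv_l by lra. nra. }
  assert (Fv : F v <= 0).
  { apply Rnot_lt_le. intros L.
    destruct (schroder_near_0 (F v / 2) ltac:(lra)) as [d2 [Hd2 N2]].
    destruct (descend_scale v d2 ltac:(lra) Hd2) as [n Hn].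
    specialize (Fiter n). set (w := v / beta ^ n) in *.
    destruct (N2 w) as [_ N]; [rewrite Rabs_pos_eq; lra|].
    rewrite (Rabs_pos_eq w) in N by lra.
    assert (F w <= F v / 2); [|lra].
    unfold F at 1. apply (Rmult_le_reg_r w); [lra|]. unfold Rdiv at 1.
    rewrite Rmult_assoc, Rinv_l, Rmult_1_r by lra.
    assert (exp (- K * w) <= 1).
    { rewrite <- exp_0. apply exp_le_compat. nra. }
    pose proof (Rabs_pos (im w)). pose proof (exp_pos (- K * w)). nra. }
  assert (Rabs (im v) = 0).
  { assert (F v = 0) by (pose proof (F0 v ltac:(lra)); lra). unfold F in H.
    pose proof (exp_pos (- K * v)).
    apply (f_equal (fun x => x * v / exp (- K * v))) in H.
    replace (Rabs (im v) * exp (- K * v) / v * v / exp (- K * v)) with (Rabs (im v)) in H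
      by (field; lra). rewrite H. field. lra. }
  destruct (Req_dec (im v) 0); auto. apply Rabs_no_R0 in H1. contradiction.
Qed.

Lemma schroder_real u : 0 < u -> Sf (Cof u) = Cof (sg u).
Proof.
  intros Hu. pose proof (schroder_im_0 u Hu) as I. unfold im, Cim in I.
  unfold sg, Cre, Cof at 2. rewrite <- I. apply surjective_pairing.
Qed.

Lemma schroder_sg u : 0 < u -> sg (beta * u) = lam * exp (sg u).
Proof.
  intros Hu. unfold sg at 1. rewrite schroder_real_eq, schroder_real, Efun_eq by auto.
  unfold Cre, Cof; simpl. rewrite cos_0. ring.
Qed.

Lemma schroder_ge_beta u : 0 < u -> beta <= sg u.
Proof.
  destruct (schroder_near_0 (/ 2) ltac:(lra)) as [d1 [Hd1 N1]].
  revert u. apply (schroder_induction _ d1 Hd1).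
  - intros u Hu. destruct (N1 u) as [N _]; [rewrite Rabs_pos_eq; lra|].
    rewrite (Rabs_pos_eq u) in N by lra. apply Rabs_le_between in N. lra.
  - intros u Hu IH. rewrite schroder_sg by auto. rewrite <- Hfix at 1.
    apply Rmult_le_compat_l; [lra|]. apply exp_le_compat; auto.
Qed.

(** Near 0 the expansion S(u) = beta + u + o(u) secures half of the increment (q - 1) u. Further
    out, E expands by at least beta on [beta, infinity), matching the scaling of the left side. *)
Lemma schroder_gap q u : 1 < q -> 0 < u -> (q - 1) / 2 * u <= sg (q * u) - sg u.
Proof.
  intros Hq. set (e := (q - 1) / (2 * (q + 1))).
  assert (He : 0 < e) by (apply Rdiv_lt_0_compat; lra).
  destruct (schroder_near_0 e He) as [d1 [Hd1 N1]].
  revert u. apply (schroder_induction _ (d1 / q)); [apply Rdiv_lt_0_compat; lra| |].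
  - intros u [Hu Hu2].
    assert (q * u < d1).
    { apply (Rmult_lt_compat_l q) in Hu2; [|lra].
      replace (q * (d1 / q)) with d1 in Hu2 by (field; lra). auto. }
    assert (u < q * u) by nra.
    destruct (N1 u) as [A _]; [rewrite Rabs_pos_eq; lra|].
    destruct (N1 (q * u)) as [B _]; [rewrite Rabs_pos_eq; lra|].
    rewrite (Rabs_pos_eq (q * u)) in B by lra.
    rewrite (Rabs_pos_eq u) in A by lra.
    apply Rabs_le_between in A. apply Rabs_le_between in B.
    assert (e * u + e * (q * u) = (q - 1) / 2 * u) by (unfold e; field; lra).
    lra.
  - intros u Hu IH. replace (q * (beta * u)) with (beta * (q * u)) by ring.
    rewrite schroder_sg by (apply Rmult_lt_0_compat; lra).
    replace (sg (q * u)) with (sg u + (sg (q * u) - sg u)) by ring.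
    rewrite exp_plus. pose proof (exp_ineq1_le (sg (q * u) - sg u)).
    pose proof (schroder_ge_beta (beta * u) ltac:(nra)) as G.
    rewrite schroder_sg in * by auto.
    set (x := lam * exp (sg u)) in *. set (D := sg (q * u) - sg u) in *.
    replace (lam * (exp (sg u) * exp D) - x) with (x * (exp D - 1)) by (unfold x; ring).
    assert (0 < (q - 1) / 2 * u) by (apply Rmult_lt_0_compat; lra).
    replace ((q - 1) / 2 * (beta * u)) with (beta * ((q - 1) / 2 * u)) by ring.
    apply Rmult_le_compat; lra.
Qed.

Lemma schroder_increasing u v : 0 < u -> u < v -> sg u < sg v.
Proof.
  intros Hu Huv. pose proof (schroder_gap (v / u) u) as G.
  assert (1 < v / u).
  { apply (Rmult_lt_reg_r u); auto. unfold Rdiv. rewrite Rmult_assoc, Rinv_l; lra. }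
  specialize (G H Hu). replace (v / u * u) with v in G by (field; lra).
  assert (0 < (v / u - 1) / 2 * u) by (apply Rmult_lt_0_compat; lra). lra.
Qed.

Lemma schroder_nondecreasing u v : 0 < u -> u <= v -> sg u <= sg v.
Proof. intros Hu [H| ->]; [left; apply schroder_increasing; auto|lra]. Qed.

(** With v = beta w, the quotient S(q v) / S(v) equals exp(S(q w) - S(w)), which is at least 1 + (q
    - 1) w / 2. *)
Lemma schroder_growth q C : 1 < q -> 0 < C ->
  exists V, 0 < V /\ forall v, V <= v -> C * sg v <= sg (q * v).
Proof.
  intros Hq HC. exists (beta * (2 * C / (q - 1))).
  assert (0 < 2 * C / (q - 1)) by (apply Rdiv_lt_0_compat; lra).
  split; [nra|]. intros v Hv.
  set (w := v / beta). assert (Hw : 2 * C / (q - 1) <= w).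
  { unfold w. apply (Rmult_le_reg_l beta); [lra|].
    replace (beta * (v / beta)) with v by (field; lra). auto. }
  replace v with (beta * w) by (unfold w; field; lra).
  replace (q * (beta * w)) with (beta * (q * w)) by ring.
  rewrite !schroder_sg by nra.
  pose proof (schroder_gap q w Hq ltac:(lra)) as G.
  replace (sg (q * w)) with (sg w + (sg (q * w) - sg w)) by ring.
  rewrite exp_plus. pose proof (exp_ineq1_le (sg (q * w) - sg w)).
  assert (C <= (q - 1) / 2 * w).
  { apply (Rmult_le_compat_l ((q - 1) / 2)) in Hw; [|lra].
    replace ((q - 1) / 2 * (2 * C / (q - 1))) with C in Hw by (field; lra). auto. }
  pose proof (exp_pos (sg w)).
  replace (lam * (exp (sg w) * exp (sg (q * w) - sg w)))
    with (exp (sg (q * w) - sg w) * (lam * exp (sg w))) by ring.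
  apply Rmult_le_compat_r; [nra|lra].
Qed.

Lemma schroder_iter n u : 0 < u -> sg (beta ^ n * u) = Er lam n (sg u).
Proof.
  intros Hu. induction n as [|n IH]; [simpl; f_equal; ring|].
  simpl. rewrite Rmult_assoc, schroder_sg, IH; auto.
  apply Rmult_lt_0_compat; auto. apply pow_lt; lra.
Qed.

Lemma schroder_continuous u : continuity_pt sg u.
Proof.
  intros eps He. destruct (Hent (Cof u)) as [d Hdd].
  destruct (has_cderiv_continuous Sf (Cof u) d eps Hdd He) as [del [H1 H2]].
  exists del. split; auto. intros x [_ Hx]. simpl in *. unfold Rdist in *.
  specialize (H2 (Cof (x - u))).
  replace (Cadd (Cof u) (Cof (x - u))) with (Cof x) in H2
    by (unfold Cadd, Cof; simpl; f_equal; ring).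
  eapply Rle_lt_trans; [apply Rabs_fst_sub_le|]. apply H2.
  eapply Rle_lt_trans; [apply Cabs_le_sum|]. unfold Cof; simpl. rewrite Rabs_R0. lra.
Qed.

Lemma schroder_unbounded x : exists u, 0 < u /\ x <= sg u.
Proof.
  destruct (schroder_growth 2 2 ltac:(lra) ltac:(lra)) as [V [HV G]].
  assert (K : forall n, 2 ^ n <= sg (2 ^ n * V)).
  { induction n as [|n IH].
    - simpl. rewrite Rmult_1_l. pose proof (schroder_ge_beta V HV). lra.
    - assert (1 <= 2 ^ n) by (apply pow_R1_Rle; lra).
      simpl. rewrite (Rmult_assoc 2). specialize (G (2 ^ n * V) ltac:(nra)). lra. }
  destruct (Pow_x_infinity 2 ltac:(rewrite Rabs_pos_eq; lra) x) as [n Hn].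
  specialize (Hn n ltac:(lia)).
  assert (0 < 2 ^ n) by (apply pow_lt; lra). rewrite Rabs_pos_eq in Hn by lra.
  exists (2 ^ n * V). split; [nra|]. specialize (K n). lra.
Qed.

Lemma schroder_surjective x : beta < x -> exists u, 0 < u /\ sg u = x.
Proof.
  intros Hx. destruct (schroder_unbounded (x + 1)) as [v [Hv Gv]].
  assert (S0 : sg 0 = beta) by (unfold sg; rewrite H0; reflexivity).
  destruct (IVT_interv (fun u => sg u - x) 0 v) as [u [Hu1 Hu2]].
  - intros a Ha. apply continuity_pt_minus; [apply schroder_continuous|].
    apply continuity_pt_const. intros ? ?. reflexivity.
  - auto.
  - rewrite S0. lra.
  - lra.
  - exists u. destruct Hu1 as [[Hu|<-] _]; [split; [auto|lra]|rewrite S0 in Hu2; lra].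
Qed.

(** [v0] comes before [C] because it fixes the family of points; only the scale [delta] depends on
    [C]. *)
Lemma gauge_estimate T s : doubling lam T -> 1 < s ->
  exists v0, 0 < v0 /\ T <= sg v0 /\
    forall C, 0 < C -> exists delta, 0 < delta /\
      forall d u j, 0 < d < delta -> 0 < u -> sg u = / d ->
        / d < Er lam (S j) (5 * sg v0) ->
        C * sg (Rpower beta (- s) * u) <= Er lam j (sg v0).
Proof.
  intros D Hs. set (q := Rpower beta ((s - 1) / 2)).
  assert (Hq : 1 < q).
  { unfold q. rewrite <- (Rpower_O beta) at 1 by lra. apply Rpower_lt; lra. }
  destruct (schroder_growth q 5 Hq ltac:(lra)) as [V1 [HV1 G1]].
  destruct (schroder_unbounded T) as [u1 [Hu1 Gu1]].
  exists (Rmax V1 u1). set (v0 := Rmax V1 u1).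
  pose proof (Rmax_l V1 u1). pose proof (Rmax_r V1 u1). fold v0 in H, H1.
  assert (Hv0 : 0 < v0) by lra.
  assert (HT : T <= sg v0) by (eapply Rle_trans; [exact Gu1|]; apply schroder_nondecreasing; auto).
  split; [auto|]. split; [auto|]. intros C HC.
  destruct (schroder_growth q C Hq HC) as [V2 [HV2 G2]].
  destruct (Pow_x_infinity beta ltac:(rewrite Rabs_pos_eq; lra) (V2 * q / v0)) as [J HJ].
  specialize (HJ J ltac:(lia)). rewrite Rabs_pos_eq in HJ by (left; apply pow_lt; lra).
  pose proof (proj1 D) as D1.
  pose proof (Er_ge_T lam T (5 * sg v0) J D ltac:(lra)) as EJ.
  exists (/ Er lam J (5 * sg v0)). split; [apply Rinv_0_lt_compat; lra|].
  intros d u j Hdd Hu Eu Hj.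
  (* Small [d] forces a late crossing index; [J] is large enough for beta^J v0 / q to reach [V2],
     where the growth bound starts. *)
  assert (JJ : (J <= j)%nat).
  { apply Nat.nlt_ge. intros L.
    pose proof (Er_monotone_index lam T (5 * sg v0) (S j) J D ltac:(lra) L).
    assert (Er lam J (5 * sg v0) < / d); [|lra].
    rewrite <- (Rinv_inv (Er lam J (5 * sg v0))). apply Rinv_lt_contravar; [|lra].
    apply Rmult_lt_0_compat; [lra|]. apply Rinv_0_lt_compat; lra. }
  assert (Hu2 : u <= beta ^ S j * (q * v0)).
  { apply Rnot_lt_le. intros L.
    assert (0 < beta ^ S j * (q * v0)).
    { apply Rmult_lt_0_compat; [apply pow_lt; lra|apply Rmult_lt_0_compat; lra]. }
    pose proof (schroder_nondecreasing _ _ H2 (Rlt_le _ _ L)) as N.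
    rewrite schroder_iter in N by (apply Rmult_lt_0_compat; lra).
    pose proof (Er_monotone lam (S j) (5 * sg v0) (sg (q * v0)) ltac:(lra) (G1 v0 H)). lra. }
  (* The factor beta accounts for passing from index j + 1 to j, one q for replacing 5 S(v0) by S(q
     v0); the other q is what keeps [w] below beta^j v0. *)
  assert (Hq0 : Rpower beta (- s) * beta * q * q = 1).
  { unfold q. rewrite <- (Rpower_1 beta) at 2 by lra. rewrite <- !Rpower_plus.
    replace (- s + 1 + (s - 1) / 2 + (s - 1) / 2) with 0 by field. apply Rpower_O; lra. }
  assert (Rp : 0 < Rpower beta (- s)) by apply exp_pos.
  set (w := beta ^ j * v0 / q).
  assert (Pj : 0 < beta ^ j) by (apply pow_lt; lra).
  assert (Hw : V2 <= w).
  { unfold w. apply (Rmult_le_reg_r q); [lra|].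
    replace (beta ^ j * v0 / q * q) with (beta ^ j * v0) by (field; lra).
    apply Rle_trans with (beta ^ J * v0).
    - apply Rge_le in HJ. apply (Rmult_le_compat_r v0) in HJ; [|lra].
      replace (V2 * q / v0 * v0) with (V2 * q) in HJ by (field; lra). auto.
    - apply Rmult_le_compat_r; [lra|]. apply Rle_pow; auto; lra. }
  assert (Hwu : Rpower beta (- s) * u <= w).
  { apply Rle_trans with (Rpower beta (- s) * (beta ^ S j * (q * v0)));
      [apply Rmult_le_compat_l; lra|].
    right. unfold w. simpl.
    replace (Rpower beta (- s) * (beta * beta ^ j * (q * v0)))
      with ((Rpower beta (- s) * beta * q * q) * (beta ^ j * v0 / q)) by (field; lra).
    rewrite Hq0. ring. }
  apply Rle_trans with (C * sg w).
  - apply Rmult_le_compat_l; [lra|]. apply schroder_nondecreasing; auto. apply Rmult_lt_0_compat; auto.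
  - eapply Rle_trans; [apply G2; auto|].
    replace (q * w) with (beta ^ j * v0) by (unfold w; field; lra).
    rewrite schroder_iter by auto. lra.
Qed.

Lemma Julia_minus_endpoints_infinite (Hlam : lam < exp (-1)) s (h : R -> R) t0 :
  1 < s -> 0 < t0 -> h 0 = 0 ->
  (forall t u, 0 < t < t0 -> Sf (Cof u) = Cof (/ t) ->
     h t = t / sg (Rpower beta (- s) * u)) ->
  Hausdorff_infinite h (fun z => Julia lam z /\ ~ endpoint lam z).
Proof.
  intros Hs Ht0 h0 Hh M.
  destruct (shadowing_threshold lam Hl) as [T [D ADM]]. pose proof (proj1 D) as D1.
  destruct (gauge_estimate T s D Hs) as [v0 [Hv0 [HA G]]]. set (A := sg v0) in *.
  (* The terms [h (dU k) / B] then sum to at most 1/4; the geometric allowance adds at most 1/4, for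
     a total mass of at most 1/2. *)
  set (B := 4 * (Rabs M + 1)). pose proof (Rabs_pos M).
  assert (HB : 0 < B) by (unfold B; lra).
  (* A box has length 62 = 2 * 31 times the diameter; 31 instead of the 30 of [separation] makes the
     inequalities strict, as an open box demands. *)
  destruct (G (62 * B) ltac:(lra)) as [del [Hdel Gd]]. clear G.
  (* [del] serves the gauge estimate, 1/3 [separation], [t0] the formula for [h]; the last bound
     keeps 1/d above beta, in the range of S on the positive axis. *)
  set (delta := Rmin (Rmin del (/ 3)) (Rmin t0 (/ (beta + 1)))).
  assert (Hb1 : 0 < / (beta + 1)) by (apply Rinv_0_lt_compat; lra).
  assert (Hdelta : delta <= del /\ delta <= / 3 /\ delta <= t0 /\ delta <= / (beta + 1)).
  { unfold delta, Rmin. repeat destruct (Rle_dec _ _); lra. }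
  assert (delta0 : 0 < delta) by (unfold delta; repeat apply Rmin_pos; lra).
  exists delta. split; auto. clearbody delta. intros U dU HU HC. apply NNPP. intros NO.
  assert (Hsum : forall N, sum_f_R0 (fun k => h (dU k)) N <= M).
  { intros N. apply Rnot_lt_le. intros L. apply NO. eauto. }
  assert (hd : forall d, 0 < d < delta -> exists u, 0 < u /\ sg u = / d /\
                 h d = d / sg (Rpower beta (- s) * u) /\ 0 < sg (Rpower beta (- s) * u)).
  { intros d Hdd.
    destruct (schroder_surjective (/ d)) as [u [Hu Eu]].
    - apply Rlt_le_trans with (beta + 1); [lra|].
      rewrite <- (Rinv_inv (beta + 1)). apply Rinv_le_contravar; lra.
    - exists u. split; auto. split; auto. split.
      + apply Hh; [lra|]. rewrite <- Eu.
        exact (schroder_real u Hu).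
      + apply Rlt_le_trans with beta; [lra|].
        apply (schroder_ge_beta).
        apply Rmult_lt_0_compat; auto. apply exp_pos. }
  assert (hn : forall k, 0 <= h (dU k)).
  { intros k. destruct (HU k) as [K1 K2]. apply is_diam_nonneg in K1.
    destruct K1 as [K1|K1]; [|rewrite <- K1, h0; lra].
    destruct (hd (dU k) ltac:(lra)) as [u [_ [_ [-> Q]]]].
    left. apply Rdiv_lt_0_compat; auto. }
  assert (ErA : forall n, 0 < Er lam n A).
  { intros n. pose proof (Er_ge_T lam T A n D HA). lra. }
  set (N := digits lam A).
  assert (Npos : forall i, (0 < N i)%nat) by (intros i; apply digits_spec, ErA).
  assert (box : forall k, exists b : (nat -> nat) * nat * (R * R),
    fst (snd b) <= snd (snd b) /\
    (snd (snd b) - fst (snd b)) / prod_lt (fun i => INR (N i)) (snd (fst b))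
      <= h (dU k) / B + / 8 * (/ 2) ^ k /\
    forall s' t' z', 2 * A + 1 <= t' <= 2 * A + 2 -> tracks lam s' t' z' -> U k z' ->
      (forall i, (i < snd (fst b))%nat -> fst (fst b) i = s' i) /\
      fst (snd b) < t' < snd (snd b)).
  { intros k. pose proof (hn k) as hk. destruct (HU k) as [K1 K2].
    pose proof (is_diam_nonneg _ _ K1) as K3.
    assert (e0 : 0 < / 8 * (/ 2) ^ k).
    { apply Rmult_lt_0_compat; [lra|]. apply pow_lt; lra. }
    assert (hB : 0 <= h (dU k) / B).
    { unfold Rdiv. apply Rmult_le_pos; auto. left; apply Rinv_0_lt_compat; auto. }
    destruct (excluded_middle_informative (exists s' t' z',
      2 * A + 1 <= t' <= 2 * A + 2 /\ tracks lam s' t' z' /\ U k z'))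
      as [[s1 [t1 [z1 [Ht1 [H1 Uz1]]]]]|NE].
    2:{ exists (fun _ => 0%nat, 0%nat, (0, 0)). simpl. split; [lra|]. split; [lra|].
        intros s' t' z' X1 X2 X3. exfalso. apply NE. exists s', t', z'. auto. }
    destruct K3 as [K3|K3].
    - destruct (separation lam T s1 t1 z1 (dU k) Hl D ltac:(lra) H1 ltac:(lra))
        as [j [J1 J2]].
      exists (s1, S j, (t1 - 31 * dU k, t1 + 31 * dU k)).
      cbn [fst snd]. split; [lra|]. split.
      + destruct (hd (dU k) ltac:(lra)) as [u [Hu [Eu [Eh Q]]]].
        destruct (digits_spec lam A j (ErA j)) as [_ [Nj _]].
        eapply Rle_trans; [apply (div_prod_lt_le N j _ (Er lam j A)); auto; lra|].
        assert (GG : 62 * B * sg (Rpower beta (- s) * u) <= Er lam j A).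
        { apply (Gd (dU k)); auto; [lra|].
          (* Since [t1 <= 2 * A + 2] and [A >= 20], 2 (t1 + 1) <= 5 A. *)
          eapply Rlt_le_trans; [exact J1|]. apply Er_monotone; lra. }
        rewrite Eh. set (g := sg (Rpower beta (- s) * u)) in *.
        apply Rle_trans with (dU k / g / B); [|lra].
        apply (Rmult_le_reg_r (Er lam j A)); [auto|].
        replace ((t1 + 31 * dU k - (t1 - 31 * dU k)) / Er lam j A * Er lam j A)
          with (62 * dU k) by (field; apply Rgt_not_eq, ErA).
        replace (62 * dU k) with (dU k / g / B * (62 * B * g)) by (field; lra).
        apply Rmult_le_compat_l; auto.
        left. repeat apply Rdiv_lt_0_compat; auto.
      + intros s' t' z' X1 X2 X3.
        destruct (J2 s' t' z' ltac:(lra) X2) as [Y1 Y2].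
        { apply (is_diam_ge (U k)); auto. }
        split; [intros; apply Y1; lia|]. apply Rabs_le_between in Y2. lra.
    (* At diameter 0 the gauge supplies no mass, so an artificial diameter [e] is used, with 62 e
       equal to the allowance of index [k], and no digit is fixed. *)
    - set (e := / 8 * (/ 2) ^ k / 62). assert (e1 : 0 < e) by (unfold e; lra).
      assert (e2 : e < / 3).
      { assert ((/ 2) ^ k <= 1); [|unfold e; lra].
        rewrite pow_inv, <- Rinv_1. apply Rinv_le_contravar; [lra|].
        apply pow_R1_Rle; lra. }
      destruct (separation lam T s1 t1 z1 e Hl D ltac:(lra) H1 ltac:(lra)) as [j [J1 J2]].
      exists (s1, 0%nat, (t1 - 31 * e, t1 + 31 * e)).
      cbn [fst snd]. split; [lra|]. split.
      + simpl prod_lt. unfold e in *. lra.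
      + intros s' t' z' X1 X2 X3. split; [intros; lia|].
        destruct (J2 s' t' z' ltac:(lra) X2) as [_ Y2].
        { eapply Rle_trans; [apply (is_diam_ge (U k) (dU k)); auto|]. lra. }
        apply Rabs_le_between in Y2. lra. }
  set (bx := fun k => constructive_indefinite_description _ (box k)).
  destruct (descent N (fun k => fst (fst (proj1_sig (bx k))))
    (fun k => snd (fst (proj1_sig (bx k)))) (fun k => fst (snd (proj1_sig (bx k))))
    (fun k => snd (snd (proj1_sig (bx k)))) (2 * A + 1) (/ 2)) as [w [t [Hw [Ht Hcov]]]].
  - auto.
  - intros k. exact (proj1 (proj2_sig (bx k))).
  - lra.
  - intros K.
    apply Rle_trans with (sum_f_R0 (fun k => h (dU k) * / B + (/ 2) ^ k * / 8) K).
    { apply sum_Rle. intros k _. pose proof (proj1 (proj2 (proj2_sig (bx k)))) as Q.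
      cbv beta. eapply Rle_trans; [exact Q|]. unfold Rdiv. lra. }
    rewrite sum_plus, <- !scal_sum, sum_half_pow.
    assert (0 < (/ 2) ^ K) by (apply pow_lt; lra).
    assert (/ B * sum_f_R0 (fun k => h (dU k)) K <= / 4).
    { apply (Rmult_le_reg_l B); auto. rewrite <- Rmult_assoc, Rinv_r, Rmult_1_l by lra.
      pose proof (Hsum K). pose proof (Rle_abs M). unfold B. lra. }
    lra.
  - assert (adms : forall t', 2 * A <= t' -> adm lam T w t').
    { intros t' Ht'. apply (ADM A); auto. intros n.
      apply (digits_spec lam A n (ErA n)), Hw. }
    destruct (tracks_exists lam T w t Hl D (adms t ltac:(lra))) as [z Hz].
    destruct (HC z) as [k Uk].
    + split.
      * exact (tracks_Julia lam T w t z Hl Hlam D (adms t ltac:(lra)) Hz).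
      (* Potentials start at 2 A + 1, so both neighbours of [t] are still admissible with the same
         digits. *)
      * apply (tracks_not_endpoint lam T w (t - 1 / 2) t (t + 1 / 2) z); auto;
          try (apply adms); lra.
    + apply (Hcov k).
      exact (proj2 (proj2 (proj2_sig (bx k))) w t z ltac:(lra) Hz Uk).
Qed.

End Schroder.

Theorem theorem1p2 :
  forall (lam beta s : R) (S : Cx -> Cx) (h : R -> R) (t0 : R),
    0 < lam -> lam < exp (-1) ->
    1 < beta -> lam * exp beta = beta ->
    entire S ->
    (forall z, S (Cmul (Cof beta) z) = Efun lam (S z)) ->
    S (Cof 0) = Cof beta ->
    has_cderiv S (Cof 0) (Cof 1) ->
    1 < s ->
    0 < t0 ->
    h 0 = 0 ->
    (* h(t) = t / L^s(1/t) for small t > 0, where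
       L^s(x) = S(beta^(-s) S^{-1}(x)) *)
    (forall t u, 0 < t < t0 -> S (Cof u) = Cof (/ t) ->
       h t = t / Cre (S (Cof (Rpower beta (- s) * u)))) ->
    Hausdorff_infinite h (fun z => Julia lam z /\ ~ endpoint lam z).
Proof.
  intros lam beta s Sf h t0 Hl Hlam Hb Hfix Hent Heq H0 Hd Hs Ht0 h0 Hh.
  exact (Julia_minus_endpoints_infinite lam beta Sf Hl Hb Hent Heq H0 Hd Hfix
           Hlam s h t0 Hs Ht0 h0 Hh).
Qed.
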